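(* Let $N$ be a positive integer, $L_1\ge\cdots\ge L_K$ nonnegative integers with $L_1\le N$, and $M=\sum_i L_i$. Then $c((N^{L_1}),\ldots,(N^{L_K});(M^N))=c((N^{N-L_1}),\ldots,(N^{N-L_K});((KN-M)^N))$.
   Context: Littlewood–Richardson coefficients are defined by $\prod_i s_{\lambda^i}=\sum_\mu c(\lambda^1,\ldots,\lambda^K;\mu)s_\mu$ for Schur polynomials $s_\lambda$; $(a^b)$ denotes the rectangular partition with $b$ parts equal to $a$ (empty if $b=0$). *)

(* Defs.v *)
From HB Require Import structures.
From mathcomp Require Import all_boot all_order all_algebra.
From mathcomp Require Import mpoly.
From Stdlib Require Import ClassicalEpsilon.
Set Implicit Arguments. Unset Strict Implicit. Unset Printing Implicit Defensive.
Import GRing.Theory.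
Local Open Scope ring_scope.

(* Partitions are represented as seq nat, nonincreasing; trailing zeros are
   harmless (the Schur polynomial ignores them and [strip] removes them). *)

Definition incell (la : seq nat) r c (x : 'I_r * 'I_c) : bool :=
  (x.2 < nth 0 la x.1)%N.

Definition ssyt (la : seq nat) n
    (t : {ffun 'I_(size la) * 'I_(head 0%N la) -> 'I_n}) : bool :=
  [forall x, forall y,
     (incell la x && incell la y) ==>
       ((((x.1 : nat) == y.1) && (x.2 <= y.2)%N) ==> (t x <= t y)%N) &&
       ((((x.2 : nat) == y.2) && (x.1 < y.1)%N) ==> (t x < t y)%N)]
  && [forall x, ~~ incell la x ==> ((t x : nat) == 0%N)].

Definition schur n (la : seq nat) : {mpoly int[n]} :=
  \sum_(t : {ffun 'I_(size la) * 'I_(head 0%N la) -> 'I_n} | ssyt t)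
     \prod_(x | incell la x) 'X_(t x).

Definition strip (s : seq nat) : seq nat := [seq x <- s | (0 < x)%N].

Definition ispart n d (nu : {ffun 'I_n -> 'I_d.+1}) : bool :=
  [forall i : 'I_n, forall j : 'I_n, ((i : nat) <= j)%N ==> (nu j <= nu i)%N]
  && ((\sum_(i < n) (nu i : nat))%N == d).

Definition part_of n d (nu : {ffun 'I_n -> 'I_d.+1}) : seq nat :=
  strip [seq (nu i : nat) | i <- enum 'I_n].

(* c is an expansion of prod_i s_{ls_i} in the Schur basis, in n = d
   variables, where d = total size (so no Schur function of degree d
   vanishes and the coefficients are the symmetric-function ones). *)
Definition lr_expansion (ls : seq (seq nat)) (c : seq nat -> int) : Prop :=
  let d := sumn (map sumn ls) in
  \prod_(la <- ls) schur d la =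
  \sum_(nu : {ffun 'I_d -> 'I_d.+1} | ispart nu)
     c (part_of nu) *: schur d (part_of nu).

(* Littlewood-Richardson coefficient c(la^1,...,la^K; mu): the coefficient
   of s_mu in the (unique) Schur expansion of prod_i s_{la^i}. *)
Definition lrc (ls : seq (seq nat)) (mu : seq nat) : int :=
  epsilon (inhabits (fun _ : seq nat => 0)) (lr_expansion ls) (strip mu).

(* Main.v *)
Require Import Defs.
From HB Require Import structures.
From mathcomp Require Import all_boot all_order all_fingroup all_algebra.
From mathcomp Require Import mpoly zify.
From Stdlib Require Import FunctionalExtensionality ClassicalEpsilon.
Set Implicit Arguments. Unset Strict Implicit. Unset Printing Implicit Defensive.
Import Order.TTheory GRing.Theory.
Local Open Scope ring_scope.

(** Cutting a semistandard tableau along its largest entry turns a Schur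
    polynomial into a sum over Gelfand-Tsetlin patterns. In that form two
    facts are immediate: adjacent variables may be swapped (reflect each entry
    of one row of the pattern inside the interval allowed by its neighbours),
    and in [N] variables [s_(B^N - reversed la)(x) = (x_1 ... x_N)^B s_la(1/x)]
    (complement every row of the pattern).

    Symmetry together with the unitriangularity of Schur polynomials for the
    monomial order yields existence and uniqueness of Schur expansions. Since
    [(M^N)] has at most [N] rows, its coefficient can be read in [N] variables.
    There, substituting [1/x] and multiplying by [(x_1 ... x_N)^(KN)] maps each
    [(N^L_i)] to [(N^(N-L_i))] and [(M^N)] to [((KN-M)^N)]. Partitions wider
    than [KN] have no complement in that box, so the two expansions are compared
    after a further multiplication by [(x_1 ... x_N)^d], [d] the total size. *)

(** * Interlacing shapes *)

Section Shapes.
Variable D : nat.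

(** A row is coded as a finite function so that sums over patterns range over a finite type; [D]
    bounds row indices and row lengths at once. *)
Definition bshape := {ffun 'I_D.+1 -> 'I_D.+1}.
HB.instance Definition _ := Finite.on bshape.

Definition row_len (m : bshape) (i : nat) : nat :=
  if (i <= D)%N then m (inord i) : nat else 0%N.

Definition shape_of (f : nat -> nat) : bshape := [ffun i : 'I_D.+1 => inord (f i)].

Definition fits (f : nat -> nat) :=
  (forall i, f i <= D)%N /\ (forall i, D < i -> f i = 0)%N.

Definition weight (f : nat -> nat) : nat := (\sum_(i < D.+1) f i)%N.

(** For partitions this says that [la / mu] is a horizontal strip. *)
Definition interlaced (la mu : nat -> nat) : bool :=
  [forall i : 'I_D.+1, la i.+1 <= mu i <= la i]%N.

Lemma fits_row_len m : fits (row_len m).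
Proof.
split=> i; rewrite /row_len; case: ifP => //; last by lia.
by move=> _; rewrite -ltnS.
Qed.

Lemma shape_ofK f : fits f -> row_len (shape_of f) = f.
Proof.
move=> [fD f0]; apply: functional_extensionality => i; rewrite /row_len.
case: ifP => [iD|/negbT]; last by rewrite -ltnNge => /f0 ->.
by rewrite ffunE inordK ?inordK ?ltnS.
Qed.

Lemma row_lenK : cancel row_len shape_of.
Proof.
move=> m; apply/ffunP=> i; rewrite ffunE /row_len -ltnS ltn_ord.
by rewrite inord_val inord_val.
Qed.

Lemma interlacedP la mu : fits la -> fits mu ->
  reflect (forall i, la i.+1 <= mu i <= la i)%N (interlaced la mu).
Proof.
move=> [_ la0] [_ mu0]; apply: (iffP forallP) => [h i|h i]; last exact: h.
case: (leqP i D) => [iD|Di].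
  by have := h (inord i); rewrite inordK // ltnS.
by rewrite la0 ?mu0 // leqW.
Qed.

Lemma interlaced_mono la mu : fits la -> fits mu -> interlaced la mu ->
  forall i, (mu i.+1 <= mu i)%N.
Proof.
move=> fl fm /(interlacedP fl fm) h i.
by have := h i; have := h i.+1; lia.
Qed.

Lemma interlaced_weight la mu : interlaced la mu -> (weight mu <= weight la)%N.
Proof.
move=> /forallP h; apply: leq_sum => i _.
by case/andP: (h i).
Qed.

Lemma weight_supp k f : (k <= D.+1)%N -> (forall i, k <= i -> f i = 0)%N ->
  weight f = (\sum_(i < k) f i)%N.
Proof.
move=> kD f0; rewrite /weight -!(big_mkord xpredT f) (big_cat_nat _ kD) //=.
rewrite [X in (_ + X)%N]big_nat_cond [X in (_ + X)%N]big1 ?addn0 //.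
by move=> i /andP[/andP[/f0]].
Qed.

(* A row interlaced with both [la] (above) and [nu] (below) is a free choice of
   one entry in each interval [[bk_lo i, bk_hi i]]; reflecting these intervals
   is the Bender-Knuth involution. *)
Definition bk_lo (la nu : nat -> nat) (i : nat) : nat := maxn (la i.+1) (nu i).
Definition bk_hi (la nu : nat -> nat) (i : nat) : nat :=
  if i is j.+1 then minn (la i) (nu j) else la 0%N.
Definition bk_flip (la nu mu : nat -> nat) (i : nat) : nat :=
  (bk_lo la nu i + bk_hi la nu i - mu i)%N.

Lemma bk_boundsP la mu nu : fits la -> fits mu -> fits nu ->
  reflect (forall i, bk_lo la nu i <= mu i <= bk_hi la nu i)%N
          (interlaced la mu && interlaced mu nu).
Proof.
move=> fl fm fn; apply: (iffP andP) => [[/(interlacedP fl fm) h1 /(interlacedP fm fn) h2]|h].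
  move=> i; have := h1 i; have := h2 i; rewrite /bk_lo /bk_hi; case: i => [|i]; first by lia.
  by have := h2 i; lia.
split.
  apply/interlacedP => // i; have := h i; rewrite /bk_lo /bk_hi; case: i => [|i]; lia.
apply/interlacedP => // i; have := h i; have := h i.+1; rewrite /bk_lo /bk_hi; lia.
Qed.

(** A maximum and a minimum of the same two numbers add up to their sum, so [bk_lo i] pairs with
    [bk_hi i.+1]. What remains is [bk_hi 0], equal to [la 0], and [bk_lo D], equal to [nu D] because
    [la] vanishes past [D]. *)
Lemma weight_bk_bounds la nu : fits la ->
  (weight (bk_lo la nu) + weight (bk_hi la nu) = weight la + weight nu)%N.
Proof.
move=> [_ la0]; rewrite /weight [in RHS]big_ord_recl [X in (_ + X = _)%N]big_ord_recl.
rewrite [X in (X + _ = _)%N]big_ord_recr [X in (_ = _ + X)%N]big_ord_recr /=.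
rewrite [bk_lo la nu D]/bk_lo la0 // max0n.
have e : (\sum_(i < D) bk_lo la nu i + \sum_(i < D) minn (la (bump 0 i)) (nu (0 + i)) =
  \sum_(i < D) la (bump 0 i) + \sum_(i < D) nu i)%N.
  rewrite -!big_split; apply: eq_bigr => i _ /=.
  by rewrite /bk_lo /bump !add1n ?add0n /=; lia.
move: e; do 4! move: (\sum_(i < D) _)%N => ?; lia.
Qed.

Lemma bk_flip_fits la nu mu : fits la -> fits nu -> fits mu ->
  interlaced la mu && interlaced mu nu -> fits (bk_flip la nu mu).
Proof.
move=> fl fn fm /(bk_boundsP fl fm fn) h.
have [l1 l2] := fl; have [n1 n2] := fn.
split=> i.
  rewrite /bk_flip; apply: leq_trans (_ : (bk_hi la nu i <= D)%N).
    by have := h i; lia.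
  by case: i {h} => [|i] /=; [apply: l1|rewrite geq_min l1].
by move=> Di; rewrite /bk_flip /bk_lo /bk_hi; case: i Di {h} => // i Di;
  have := l2 _ Di; have := n2 _ Di; have := l2 i.+2 (leqW Di); lia.
Qed.

Lemma bk_flip_interlaced la nu mu : fits la -> fits nu -> fits mu ->
  interlaced la mu && interlaced mu nu ->
  interlaced la (bk_flip la nu mu) && interlaced (bk_flip la nu mu) nu.
Proof.
move=> fl fn fm h; have ff := bk_flip_fits fl fn fm h.
apply/bk_boundsP => // i; move/(bk_boundsP fl fm fn)/(_ i): h.
by rewrite /bk_flip; lia.
Qed.

Lemma bk_flipK la nu mu : fits la -> fits nu -> fits mu ->
  interlaced la mu && interlaced mu nu -> bk_flip la nu (bk_flip la nu mu) = mu.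
Proof.
move=> fl fn fm /(bk_boundsP fl fm fn) h; apply: functional_extensionality => i.
by have := h i; rewrite /bk_flip; lia.
Qed.

Lemma weight_bk_flip la nu mu : fits la -> fits nu -> fits mu ->
  interlaced la mu && interlaced mu nu ->
  (weight (bk_flip la nu mu) + weight mu = weight la + weight nu)%N.
Proof.
move=> fl fn fm /(bk_boundsP fl fm fn) h; rewrite -(weight_bk_bounds nu fl).
rewrite /weight -!big_split; apply: eq_bigr => i _.
by have := h i; rewrite /bk_flip /=; lia.
Qed.

(** The complement of [la] in a rectangle with [k] rows of length [B], turned by 180 degrees so that
    partitions in the rectangle give partitions. *)
Definition box_compl (B k : nat) (la : nat -> nat) (i : nat) : nat :=
  if (i < k)%N then (B - la (k.-1 - i))%N else 0%N.

Lemma box_compl_fits B k la : (k <= D.+1)%N -> (B <= D)%N -> fits (box_compl B k la).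
Proof.
move=> kD BD; split=> i; rewrite /box_compl; case: ifP => //; lia.
Qed.

Lemma box_complK B k la : (forall i, la i <= B)%N -> (forall i, k <= i -> la i = 0)%N ->
  box_compl B k (box_compl B k la) = la.
Proof.
move=> laB la0; apply: functional_extensionality => i; rewrite /box_compl.
case: ifP => ik; last by rewrite la0 //; lia.
rewrite (_ : (_ < k)%N); last by lia.
have -> : (k.-1 - (k.-1 - i) = i)%N by lia.
by have := laB i; lia.
Qed.

Lemma weight_box_compl B k la : (k <= D.+1)%N ->
  (forall i, la i <= B)%N -> (forall i, k <= i -> la i = 0)%N ->
  (weight (box_compl B k la) + weight la = k * B)%N.
Proof.
move=> kD laB la0; rewrite (weight_supp kD la0) (@weight_supp k) //; last first.
  by move=> i ki; rewrite /box_compl ltnNge ki.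
rewrite [X in (_ + X)%N](reindex_inj rev_ord_inj) /= -big_split /=.
rewrite (eq_bigr (fun=> B)) ?sum_nat_const ?card_ord // => i _.
rewrite /box_compl ltn_ord; have -> : (k.-1 - i = k - i.+1)%N by case: (k) i => //; lia.
by have := laB (k - i.+1)%N; lia.
Qed.

(** Complementing reverses both the order of the rows and the inequalities, and the two reversals
    cancel; the heights [k.+1] and [k] make the indices match. *)
Lemma interlaced_box_compl B k la mu : (k < D.+1)%N -> (B <= D)%N ->
  fits la -> fits mu -> (forall i, la i <= B)%N -> (forall i, mu i <= B)%N ->
  (forall i, k < i -> la i = 0)%N -> (forall i, k <= i -> mu i = 0)%N ->
  interlaced (box_compl B k.+1 la) (box_compl B k mu) = interlaced la mu.
Proof.
move=> kD BD fl fm lB mB l0 m0.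
have fl' := box_compl_fits la kD BD; have fm' := box_compl_fits mu (ltnW kD) BD.
apply/(interlacedP fl' fm')/(interlacedP fl fm) => h i.
  case: (ltnP i k) => ik; last by rewrite m0 // l0 ?ltnS.
  have := h (k.-1 - i)%N; rewrite /box_compl !ifT; try lia.
  have -> : (k.-1 - (k.-1 - i) = i)%N by lia.
  have -> : (k.+1.-1 - (k.-1 - i) = i.+1)%N by lia.
  have -> : (k.+1.-1 - (k.-1 - i).+1 = i)%N by lia.
  by have := lB i; have := lB i.+1; have := mB i; lia.
rewrite /box_compl ltnS; case: (ltnP i k) => ik; last by [].
rewrite ltnS (ltnW ik) /=; have := h (k.-1 - i)%N.
have -> : (k - i = (k.-1 - i).+1)%N by lia.
have -> : (k - i.+1 = k.-1 - i)%N by lia.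
by lia.
Qed.

End Shapes.

(** * Gelfand-Tsetlin sums *)

Section GTSum.
Variable D : nat.

(* A Gelfand-Tsetlin sum in which rows are not shortened from one level to the
   next; instead the base case makes it vanish unless [la] has at most [k]
   nonzero parts. *)
Fixpoint gtsum (R : comNzRingType) (k : nat) (la : nat -> nat) (x : nat -> R) : R :=
  if k is k'.+1 then
    \sum_(m : bshape D | interlaced D la (row_len m))
      gtsum k' (row_len m) x * x k' ^+ (weight D la - weight D (row_len m))
  else [forall i : 'I_D.+1, la i == 0]%N%:R.

Lemma rmorph_gtsum (R R' : comNzRingType) (f : {rmorphism R -> R'}) k la x :
  f (gtsum k la x) = gtsum k la (fun i => f (x i)).
Proof.
elim: k la => [|k IH] la /=; first by rewrite rmorph_nat.
by rewrite rmorph_sum; apply: eq_bigr => m _; rewrite rmorphM rmorphXn IH.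
Qed.

Variable R : comNzRingType.
Implicit Type x : nat -> R.

Lemma eq_gtsum k la x y : (forall i, i < k -> x i = y i)%N ->
  gtsum k la x = gtsum k la y.
Proof.
elim: k la => [|k IH] la //= xy; apply: eq_bigr => m _.
by rewrite xy // IH // => i ik; rewrite xy // ltnW.
Qed.

(** Interlacing gives [la k.+1 <= mu k], so a part too far down persists at every level until the
    base case rejects it. *)
Lemma gtsum_long k la x : fits D la -> la k != 0%N -> gtsum k la x = 0.
Proof.
elim: k la => [|k IH] la fl lak /=.
  by case: forallP => // /(_ ord0); rewrite (negbTE lak).
rewrite big1 // => m /(interlacedP fl (fits_row_len m)) /(_ k) h.
by rewrite IH ?mul0r //; [exact: fits_row_len|move: lak; lia].
Qed.

(** At [x k = 0] only rows with exponent 0, hence of equal weight, survive; a row entrywise below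
    [la] with the weight of [la] is [la] itself. *)
Lemma gtsum_var0 k la x : fits D la -> (forall i, la i.+1 <= la i)%N -> x k = 0 ->
  gtsum k.+1 la x = gtsum k la x.
Proof.
move=> fl dl xk /=; rewrite (bigD1 (shape_of D la)) /=; last first.
  by rewrite shape_ofK //; apply/interlacedP => // i; rewrite dl leqnn.
rewrite shape_ofK // subnn mulr1 big1 ?addr0 // => m /andP[im neq].
have lemi (i : nat) : (row_len m i <= la i)%N.
  by have /(interlacedP fl (fits_row_len m))/(_ i)/andP[] := im.
rewrite xk expr0n; case: eqP => [e|_]; rewrite ?mulr0 //.
case/eqP: neq; rewrite -[m]row_lenK; congr shape_of; apply: functional_extensionality => i.
case: (leqP i D) => iD; last by rewrite (proj2 (fits_row_len m)) // (proj2 fl).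
apply/eqP; rewrite eqn_leq lemi leqNgt; apply/negP => lt.
have : (weight D (row_len m) < weight D la)%N; last by lia.
rewrite /weight (bigD1 (inord i)) // [X in (_ < X)%N](bigD1 (inord i)) //=.
rewrite inordK //; rewrite -addSn leq_add //; apply: leq_sum => j _; exact: lemi.
Qed.

Lemma gtsum_trunc k n la x : fits D la -> (forall i, la i.+1 <= la i)%N ->
  (k <= n)%N -> (forall i, (k <= i)%N -> x i = 0) -> gtsum n la x = gtsum k la x.
Proof.
move=> fl dl kn x0; elim: n kn => [|n IH]; first by case: k x0.
rewrite leq_eqVlt => /orP[/eqP <- //|]; rewrite ltnS => kn.
by rewrite gtsum_var0 ?IH // x0.
Qed.

Lemma gtsum_empty k x : gtsum k (fun=> 0%N) x = 1.
Proof.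
have f0 : fits D (fun=> 0%N) by [].
rewrite (@eq_gtsum k _ x (fun i => if (i < k)%N then x i else 0)); last by move=> i ->.
elim: k x => [|k IH] x /=; first by case: forallP => // -[].
rewrite (bigD1 (shape_of D (fun=> 0%N))) ?shape_ofK //=; last by apply/interlacedP.
rewrite subnn mulr1 big1 ?addr0.
  by rewrite -[RHS](IH x); apply: eq_gtsum => i ik; rewrite ik ltnS ltnW.
move=> m /andP[/(interlacedP f0 (fits_row_len m)) h /eqP[]].
rewrite -[m]row_lenK; congr shape_of; apply: functional_extensionality => i.
by have := h i; lia.
Qed.

Definition swap_var k x (i : nat) : R :=
  if i == k then x k.+1 else if i == k.+1 then x k else x i.

(** The last two variables see only the top two steps of the pattern. With [la] and the row [nu] two
    levels down fixed, the Bender-Knuth reflection of the middle row exchanges their exponents. *)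
Lemma gtsum_swap_top k la x : fits D la ->
  gtsum k.+2 la (swap_var k x) = gtsum k.+2 la x.
Proof.
move=> fl /=.
pose G nu := gtsum k nu x.
have Gsw nu : gtsum k nu (swap_var k x) = G nu.
  by apply: eq_gtsum => i ik; rewrite /swap_var !ifN //; lia.
(* Reordering the sums makes [nu] the outer index, so that the flip acts on the inner sum alone. *)
have unfold (y z : R) :
  \sum_(m : bshape D | interlaced D la (row_len m))
     (\sum_(m0 : bshape D | interlaced D (row_len m) (row_len m0))
        G (row_len m0) * y ^+ (weight D (row_len m) - weight D (row_len m0))) *
     z ^+ (weight D la - weight D (row_len m)) =
  \sum_(nu : bshape D) G (row_len nu) *
    \sum_(m : bshape D | interlaced D la (row_len m) && interlaced D (row_len m) (row_len nu))
       (y ^+ (weight D (row_len m) - weight D (row_len nu)) *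
        z ^+ (weight D la - weight D (row_len m))).
  under eq_bigr => m _ do rewrite mulr_suml.
  rewrite (exchange_big_dep xpredT) //=; apply: eq_bigr => nu _.
  by rewrite mulr_sumr; apply: eq_bigr => m _; rewrite mulrA.
rewrite /swap_var !eqxx (_ : (k.+1 == k) = false); last by lia.
under eq_bigr => m _.
  under eq_bigr => m0 _ do rewrite -/(swap_var k x) Gsw.
  over.
rewrite !unfold; apply: eq_bigr => nu _; congr (_ * _).
have fn := fits_row_len nu.
pose h (m : bshape D) := shape_of D (bk_flip la (row_len nu) (row_len m)).
have hE m : interlaced D la (row_len m) && interlaced D (row_len m) (row_len nu) ->
    row_len (h m) = bk_flip la (row_len nu) (row_len m).
  by move=> im; rewrite shape_ofK //; apply: bk_flip_fits => //; apply: fits_row_len.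
rewrite (reindex_onto h h) /=; last first.
  by move=> m im; rewrite {1}/h hE // (bk_flipK fl fn (fits_row_len m) im) row_lenK.
apply: eq_big => [m|m im].
  apply/idP/idP => [/andP[im /eqP hm]|im].
    rewrite -hm hE //; apply: bk_flip_interlaced => //; exact: fits_row_len.
  rewrite {1 2}hE // bk_flip_interlaced //=; last exact: fits_row_len.
  by apply/eqP; rewrite {1}/h hE // (bk_flipK fl fn (fits_row_len m) im) row_lenK.
have {}im : interlaced D la (row_len m) && interlaced D (row_len m) (row_len nu).
  case/andP: im => im /eqP <-; rewrite hE //; apply: bk_flip_interlaced => //; exact: fits_row_len.
rewrite mulrC hE //.
have := weight_bk_flip fl fn (fits_row_len m) im.
case/andP: im => /interlaced_weight w1 /interlaced_weight w2 w.
by congr (_ ^+ _ * _ ^+ _); lia.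
Qed.

Lemma gtsum_swap k n la x : (k.+1 < n)%N -> fits D la ->
  gtsum n la (swap_var k x) = gtsum n la x.
Proof.
elim: n la => // n IH la; rewrite ltnS leq_eqVlt => /orP[/eqP <-|kn] fl.
  exact: gtsum_swap_top.
rewrite /=; apply: eq_bigr => m _; rewrite IH //; last exact: fits_row_len.
by rewrite /swap_var !ifN //; lia.
Qed.

End GTSum.

(** Complementing every row, the one with [k] entries in a box of [k] rows of length [B], turns each
    exponent [e] into [B - e]; each variable thus contributes its power [B] times the inverse of its
    power [e]. *)
Lemma gtsum_compl (D : nat) (F : fieldType) k B la (x : nat -> F) :
  (k <= D.+1)%N -> (B <= D)%N -> fits D la -> (forall i, la i <= B)%N ->
  (forall i, k <= i -> la i = 0)%N -> (forall i, (i < k)%N -> x i != 0) ->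
  gtsum D k (box_compl B k la) x =
  (\prod_(i < k) x i) ^+ B * gtsum D k la (fun i => (x i)^-1).
Proof.
elim: k la => [|k IH] la kD BD fl lB l0 x0 /=.
  rewrite big_ord0 expr1n mul1r; congr (_ _); congr nat_of_bool.
  by apply/forallP/forallP => h i; rewrite /= ?l0.
have lB' (m : bshape D) : interlaced D la (row_len m) -> forall i, (row_len m i <= B)%N.
  by move=> /(interlacedP fl (fits_row_len m)) h i; have := h i; have := lB i; lia.
(* Rows with a nonzero entry at index [k] contribute zero on either side; on the remaining ones
   complementing in [k] rows is an involution. *)
rewrite (bigID (fun m : bshape D => row_len m k == 0%N)) /= addrC big1 ?add0r; last first.
  by move=> m /andP[_ mk]; rewrite gtsum_long ?mul0r //; apply: fits_row_len.
rewrite [in RHS](bigID (fun m : bshape D => row_len m k == 0%N)) /= addrC.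
rewrite [X in _ = _ * (X + _)]big1 ?add0r; last first.
  by move=> m /andP[_ mk]; rewrite gtsum_long ?mul0r //; apply: fits_row_len.
pose h (m : bshape D) := shape_of D (box_compl B k (row_len m)).
have hE m : row_len (h m) = box_compl B k (row_len m).
  by rewrite shape_ofK //; apply: box_compl_fits => //; apply: ltnW.
have supp la' (m : bshape D) : fits D la' -> (forall i, k < i -> la' i = 0)%N -> 
    interlaced D la' (row_len m) && (row_len m k == 0)%N ->
    forall i, (k <= i -> row_len m i = 0)%N.
  move=> fl' l0' /andP[/(interlacedP fl' (fits_row_len m)) im /eqP mk] i.
  rewrite leq_eqVlt => /orP[/eqP <- //|ki].
  by have := im i; have := l0' i ki; lia.
have hK (m : bshape D) : interlaced D la (row_len m) && (row_len m k == 0)%N -> h (h m) = m.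
  move=> im; rewrite {1}/h hE box_complK ?row_lenK //; last exact: supp im.
  by apply: lB'; case/andP: im.
have flc := box_compl_fits la kD BD.
have cB (m : bshape D) : interlaced D (box_compl B k.+1 la) (row_len m) && (row_len m k == 0)%N ->
    forall i, (row_len m i <= B)%N.
  move=> /andP[/(interlacedP flc (fits_row_len m)) im _] i.
  by have := im i; rewrite /box_compl; case: (i < k.+1)%N; lia.
have csupp (m : bshape D) : interlaced D (box_compl B k.+1 la) (row_len m) && (row_len m k == 0)%N ->
    forall i, (k <= i -> row_len m i = 0)%N.
  by apply: supp => // i ki; rewrite /box_compl ltnS leqNgt ki.
have hkk m : row_len (h m) k = 0%N by rewrite hE /box_compl ltnn.
rewrite (reindex_onto h h) /=; last first.
  move=> m im; rewrite {1}/h hE box_complK ?row_lenK //; [exact: cB|exact: csupp].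
rewrite mulr_sumr; apply: eq_big => [m|m].
  rewrite hkk eqxx andbT.
  apply/idP/idP => [/andP[im /eqP hm]|im].
    have ms : forall i, (k <= i -> row_len m i = 0)%N.
      by move=> i ki; rewrite -hm hE /box_compl ltnNge ki.
    have mB : forall i, (row_len m i <= B)%N.
      by move=> i; rewrite -hm hE /box_compl; case: ifP => // _; apply: leq_subr.
    rewrite ms // eqxx andbT.
    by rewrite hE interlaced_box_compl // in im; apply: fits_row_len.
  rewrite hK // eqxx andbT hE interlaced_box_compl //; first by case/andP: im.
  - exact: fits_row_len.
  - by apply: lB'; case/andP: im.
  - exact: supp im.
rewrite hkk eqxx andbT => /andP[imc /eqP hm].
have ms : forall i, (k <= i -> row_len m i = 0)%N.
  by move=> i ki; rewrite -hm hE /box_compl ltnNge ki.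
have mB : forall i, (row_len m i <= B)%N.
  by move=> i; rewrite -hm hE /box_compl; case: ifP => // _; apply: leq_subr.
have im : interlaced D la (row_len m).
  by rewrite hE interlaced_box_compl // in imc; apply: fits_row_len.
rewrite hE IH //; first last.
- by move=> i ik; rewrite x0 // ltnW.
- exact: fits_row_len.
- exact: ltnW.
rewrite big_ord_recr /= exprMn -!mulrA; congr (_ * _).
rewrite mulrCA; congr (_ * _).
set e := (weight D la - weight D (row_len m))%N.
(* As [la i.+1 <= row_len m i], all of [la] but its first part is absorbed by the row below, so the
   weight drops by at most [la 0]. *)
have e_le : (e <= B)%N.
  rewrite /e leq_subLR /weight big_ord_recl /= addnC leq_add //.
  rewrite [X in (_ <= X)%N]big_ord_recr /= -[X in (X <= _)%N]addn0 leq_add //.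
  apply: leq_sum => i _; rewrite /bump /= add1n.
  by have /(interlacedP fl (fits_row_len m))/(_ i)/andP[] := im.
have -> : (weight D (box_compl B k.+1 la) - weight D (box_compl B k (row_len m)) = B - e)%N.
  have := weight_box_compl kD lB l0; have := weight_box_compl (ltnW kD) mB ms.
  have := interlaced_weight im; rewrite /e mulSn; move: e_le; rewrite /e; lia.
by rewrite exprVn expfB_cond // (negbTE (x0 k (ltnSn k))) /= add0n.
Qed.

(** * Branching rule for semistandard tableaux *)

Section Branching.
Variables (D n r c : nat).
Implicit Type la mu : nat -> nat.
Implicit Type t : {ffun 'I_r * 'I_c -> 'I_n.+1}.
Implicit Type p q : 'I_r * 'I_c.

Definition cell la p : bool := (p.2 < la p.1)%N.

(** The condition of [ssyt] with the frame ['I_r * 'I_c] kept fixed while the shape varies, so that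
    a tableau and its truncations share one type. Values in ['I_n.+1] provide [ord0] as filler
    outside the shape. *)
Definition tableau la t : bool :=
  [forall p, forall q,
     (cell la p && cell la q) ==>
       ((((p.1 : nat) == q.1) && (p.2 <= q.2)%N) ==> (t p <= t q)%N) &&
       ((((p.2 : nat) == q.2) && (p.1 < q.1)%N) ==> (t p < t q)%N)]
  && [forall p, ~~ cell la p ==> ((t p : nat) == 0%N)].

Definition tableau_below la k t : bool :=
  tableau la t && [forall p, cell la p ==> (t p < k)%N].

Lemma tableau_belowP la k t :
  reflect [/\ forall p q, cell la p -> cell la q -> p.1 = q.1 ->
                (p.2 <= q.2)%N -> (t p <= t q)%N,
              forall p q, cell la p -> cell la q -> p.2 = q.2 ->
                (p.1 < q.1)%N -> (t p < t q)%N,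
              forall p, ~~ cell la p -> t p = ord0 &
              forall p, cell la p -> (t p < k)%N]
          (tableau_below la k t).
Proof.
apply: (iffP idP) => [|[h1 h2 h3 h4]].
  case/andP => /andP[/forallP h1 /forallP h2] /forallP h3; split.
  - move=> p q cp cq e l; have /forallP/(_ q) := h1 p.
    by rewrite cp cq e eqxx l /= => /andP[].
  - move=> p q cp cq e l; have /forallP/(_ q) := h1 p.
    by rewrite cp cq e eqxx l /= => /andP[].
  - move=> p np; apply/val_inj => /=; apply/eqP.
    by have := h2 p; rewrite np.
  - by move=> p cp; have := h3 p; rewrite cp.
apply/andP; split; last by apply/forallP => p; apply/implyP => /h4.
apply/andP; split; last by apply/forallP => p; apply/implyP => /h3 ->.
apply/forallP => p; apply/forallP => q; apply/implyP => /andP[cp cq].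
apply/andP; split; apply/implyP => /andP[/eqP/val_inj e l]; [exact: h1|exact: h2].
Qed.

Definition in_box la :=
  [/\ fits D la, forall i, (la i.+1 <= la i)%N, forall i, (r <= i)%N -> la i = 0%N
    & forall i, (la i <= c)%N].

Lemma in_box_interlaced la (m : bshape D) :
  in_box la -> interlaced D la (row_len m) -> in_box (row_len m).
Proof.
move=> [fl dl l0 lc] im; have fm := fits_row_len m.
have h := elimT (interlacedP fl fm) im; split=> // i.
- exact: interlaced_mono im i.
- by move=> ri; have := h i; have := l0 i ri; lia.
- by have := h i; have := lc i; lia.
Qed.

Lemma nonincr_le la i j : (forall i, (la i.+1 <= la i)%N) -> (i <= j)%N -> (la j <= la i)%N.
Proof.
move=> dl; elim: j => [|j IH]; first by case: i.
rewrite leq_eqVlt => /orP[/eqP -> //|]; rewrite ltnS => /IH; exact: leq_trans.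
Qed.

(** The length of row [i] once the entries at least [k] are deleted: rows weakly increase, so the
    retained cells form an initial segment. *)
Definition low_part k la t (i : nat) : nat :=
  \max_(p | [&& cell la p, (p.1 : nat) == i & (t p < k)%N]) p.2.+1.

(** Cells that leave the shape receive the filler [ord0]; this map and [fill_entries] are the two
    directions of the branching bijection. *)
Definition drop_entries k la t : {ffun 'I_r * 'I_c -> 'I_n.+1} :=
  [ffun p => if cell la p && (t p < k)%N then t p else ord0].

Definition fill_entries k la mu t : {ffun 'I_r * 'I_c -> 'I_n.+1} :=
  [ffun p => if cell la p && ~~ cell mu p then inord k else t p].

Lemma low_partP k la t p : tableau_below la k.+1 t -> cell la p ->
  (p.2 < low_part k la t p.1)%N = (t p < k)%N.
Proof.
move=> /tableau_belowP[row _ _ _] cp; apply/idP/idP => [|tp].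
  apply: contraLR; rewrite -!leqNgt => kt; apply/bigmax_leqP => q /and3P[cq /eqP/val_inj e tq].
  rewrite ltnNge; apply/negP => le.
  by have := row _ _ cp cq (esym e) le; rewrite leqNgt (leq_trans tq kt).
by apply: (@leq_bigmax_cond _ _ (fun p : 'I_r * 'I_c => p.2.+1)); rewrite cp eqxx.
Qed.

Lemma low_part_le k la t i : (low_part k la t i <= la i)%N.
Proof. by apply/bigmax_leqP => p /and3P[cp /eqP <- _]. Qed.

Lemma cell_low_part k la t p : tableau_below la k.+1 t ->
  cell (low_part k la t) p = cell la p && (t p < k)%N.
Proof.
move=> tt; case: (boolP (cell la p)) => [cp|ncp] /=; first exact: low_partP.
apply/negP => h; case/negP: ncp; apply: leq_trans h _; exact: low_part_le.
Qed.

Lemma low_part_fits k la t : in_box la -> fits D (low_part k la t).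
Proof.
move=> [[lD l0] _ _ _]; split=> i; first exact: leq_trans (low_part_le _ _ _ _) (lD i).
by move=> /l0 e; apply/eqP; rewrite -leqn0 -e low_part_le.
Qed.

(** Were [low_part i < la i.+1], the cell of row [i] just past the retained part would hold at least
    [k], and the cell under it more than [k], against the bound [k.+1]. *)
Lemma low_part_interlaced k la t : in_box la -> tableau_below la k.+1 t ->
  interlaced D la (low_part k la t).
Proof.
move=> bx tt; have [fl dl l0 lc] := bx.
apply/interlacedP => //; first exact: low_part_fits.
move=> i; rewrite low_part_le andbT leqNgt; apply/negP => lt.
have ir : (i.+1 < r)%N by rewrite ltnNge; apply/negP => /l0 e; rewrite e in lt.
have jc : (low_part k la t i < c)%N by apply: leq_trans lt (lc _).
pose p := (Ordinal (ltnW ir), Ordinal jc); pose q := (Ordinal ir, Ordinal jc).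
have cq : cell la q by [].
have cp : cell la p by apply: leq_trans lt _; apply: dl.
have := low_partP tt cp; rewrite /= ltnn => /esym/negbT; rewrite -leqNgt.
have /tableau_belowP[_ col _ ub] := tt.
by have := col _ _ cp cq erefl (ltnSn _); have := ub _ cq; lia.
Qed.

Lemma drop_entries_tableau k la t : tableau_below la k.+1 t ->
  tableau_below (low_part k la t) k (drop_entries k la t).
Proof.
move=> tt; have /tableau_belowP[row col out ub] := tt.
apply/tableau_belowP; split=> [p q|p q|p|p]; rewrite ?cell_low_part // !ffunE.
- by move=> /andP[cp tp] /andP[cq tq]; rewrite cp tp cq tq; apply: row.
- by move=> /andP[cp tp] /andP[cq tq]; rewrite cp tp cq tq; apply: col.
- by move=> /negbTE ->.
- by move=> /andP[cp tp]; rewrite cp tp.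
Qed.

Lemma drop_entriesK k la t : (k <= n)%N -> tableau_below la k.+1 t ->
  fill_entries k la (low_part k la t) (drop_entries k la t) = t.
Proof.
move=> kn tt; have /tableau_belowP[row col out ub] := tt.
apply/ffunP => p; rewrite !ffunE cell_low_part //.
case: (boolP (cell la p)) => [cp|ncp] /=; last by rewrite out.
case: ltnP => //= kt; apply/val_inj; rewrite /= inordK ?ltnS //.
by apply/eqP; rewrite eqn_leq kt /= -ltnS ub.
Qed.

Variables (k : nat) (la : nat -> nat) (m : bshape D).
Hypotheses (kn : (k <= n)%N) (bx : in_box la) (im : interlaced D la (row_len m)).
Let mu := row_len m.

Lemma interlaced_cell p : cell mu p -> cell la p.
Proof.
have [fl _ _ _] := bx; have /(interlacedP fl (fits_row_len m)) h := im.
by move=> cp; apply: leq_trans cp _; case/andP: (h p.1).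
Qed.

Lemma fill_entries_lt t p : tableau_below mu k t -> cell la p ->
  (fill_entries k la mu t p < k)%N = cell mu p.
Proof.
move=> /tableau_belowP[_ _ _ ub] cp; rewrite ffunE cp /=.
case: (boolP (cell mu p)) => [cm|ncm] /=; first by rewrite ub.
by rewrite inordK ?ltnS // ltnn.
Qed.

Lemma fill_entries_tableau t : tableau_below mu k t ->
  tableau_below la k.+1 (fill_entries k la mu t).
Proof.
move=> tt; have /tableau_belowP[row col out ub] := tt.
have [fl dl l0 lc] := bx; have [fm dm _ _] := in_box_interlaced bx im.
have il := elimT (interlacedP fl fm) im.
have inC p := interlaced_cell (p := p).
apply/tableau_belowP; split=> [p q cp cq e le|p q cp cq e lt|p ncp|p cp].
- rewrite !ffunE cp cq /=; case: (boolP (cell mu q)) => [cmq|ncmq] /=.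
    have cmp : cell mu p by rewrite /cell e; apply: leq_ltn_trans le cmq.
    by rewrite cmp /=; apply: row.
  rewrite inordK ?ltnS //; case: (boolP (cell mu p)) => [cmp|ncmp] /=.
    exact/ltnW/ub.
  by rewrite inordK ?ltnS.
(* A cell of [la] with another one beneath it lies in [mu], as [la i.+1 <= mu i]; so at most one new
   [k] enters each column. *)
- have cmp : cell mu p.
    apply: leq_trans (_ : (la q.1 <= _)%N); first by rewrite e.
    apply: leq_trans (nonincr_le dl lt) _.
    by case/andP: (il p.1).
  rewrite !ffunE cp cq cmp /=; case: (boolP (cell mu q)) => [cmq|ncmq] /=.
    exact: col.
  by rewrite inordK ?ltnS // ub.
- rewrite ffunE (negbTE ncp) /= out //; apply: contra ncp; exact: inC.
- rewrite ffunE cp /=; case: (boolP (cell mu p)) => [cm|ncm] /=.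
    by rewrite ltnW // ltnS ub.
  by rewrite inordK ?ltnS.
Qed.

Lemma low_part_fill_entries t : tableau_below mu k t ->
  low_part k la (fill_entries k la mu t) = mu.
Proof.
move=> tt; apply: functional_extensionality => i.
have [fl dl l0 lc] := bx; have [fm dm m0 mc] := in_box_interlaced bx im.
apply/eqP; rewrite eqn_leq; apply/andP; split.
  apply/bigmax_leqP => p /and3P[cp /eqP <-]; rewrite fill_entries_lt //.
case e : (mu i) => [//|j].
have ir : (i < r)%N by rewrite ltnNge; apply/negP => /m0; rewrite -/mu e.
have jc : (j < c)%N by have := mc i; rewrite -/mu e.
pose p := (Ordinal ir, Ordinal jc).
have cm : cell mu p by rewrite /cell /= e.
apply: (@leq_bigmax_cond _ _ (fun p : 'I_r * 'I_c => p.2.+1) p).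
by rewrite interlaced_cell //= eqxx fill_entries_lt // interlaced_cell.
Qed.

Lemma fill_entriesK t : tableau_below mu k t ->
  drop_entries k la (fill_entries k la mu t) = t.
Proof.
move=> tt; apply/ffunP => p; rewrite ffunE.
have /tableau_belowP[_ _ out _] := tt.
case: (boolP (cell la p)) => [cp|ncp] /=; last first.
  by rewrite out //; apply: contra ncp; apply: interlaced_cell.
rewrite fill_entries_lt //; case: (boolP (cell mu p)) => [cm|ncm].
  by rewrite ffunE cm andbF.
by rewrite out.
Qed.

End Branching.

Section TableauSum.
Variables (D n r c : nat) (R : comNzRingType) (x : nat -> R).
Hypothesis rD : (r <= D.+1)%N.
Implicit Type la : nat -> nat.

Definition tabsum k la : R :=
  \sum_(t : {ffun 'I_r * 'I_c -> 'I_n.+1} | tableau_below la k t)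
    \prod_(p | cell la p) x (t p).

Lemma card_cells la : in_box D r c la ->
  #|[pred p : 'I_r * 'I_c | cell la p]| = weight D la.
Proof.
move=> [_ _ l0 lc]; rewrite (weight_supp rD l0) -sum1_card.
rewrite -(pair_big_dep xpredT (fun i (j : 'I_c) => cell la (i, j)) (fun _ _ => 1%N)) /=.
apply: eq_bigr => i _; rewrite /cell /=.
by rewrite -(big_ord_widen c (fun=> 1%N) (lc i)) sum1_card card_ord.
Qed.

(** Tableaux are grouped by the shape left once the entries [k] are removed; the removed cells,
    counted by the difference of the weights, give the power of [x k]. *)
Lemma tabsum_step k la : (k <= n)%N -> in_box D r c la ->
  tabsum k.+1 la = \sum_(m : bshape D | interlaced D la (row_len m))
    tabsum k (row_len m) * x k ^+ (weight D la - weight D (row_len m)).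
Proof.
move=> kn bx; have [fl dl l0 lc] := bx.
rewrite /tabsum (partition_big (fun t => shape_of D (low_part k la t))
   (fun m => interlaced D la (row_len m))) /=; last first.
  move=> t tt; rewrite shape_ofK; first exact: low_part_interlaced.
  exact: low_part_fits bx.
apply: eq_bigr => m im; have bm := in_box_interlaced bx im.
rewrite (reindex_onto (fill_entries k la (row_len m)) (drop_entries k la)) /=; last first.
  move=> t /andP[tt /eqP <-]; rewrite shape_ofK; first exact: drop_entriesK.
  exact: low_part_fits bx.
have back (t : {ffun 'I_r * 'I_c -> 'I_n.+1}) : tableau_below la k.+1 (fill_entries k la (row_len m) t) &&
    (shape_of D (low_part k la (fill_entries k la (row_len m) t)) == m) &&
    (drop_entries k la (fill_entries k la (row_len m) t) == t) ->
    tableau_below (row_len m) k t.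
  move=> /andP[/andP[tt /eqP et] /eqP dt].
  have := drop_entries_tableau tt; rewrite dt.
  suff <- : row_len m = low_part k la (fill_entries k la (row_len m) t) by [].
  by rewrite -{1}et shape_ofK //; exact: low_part_fits bx.
rewrite mulr_suml; apply: eq_big => [t|t].
  apply/idP/idP => [|tt]; first exact: back.
  rewrite (fill_entries_tableau kn bx im) // (low_part_fill_entries kn bx im) //.
  by rewrite row_lenK (fill_entriesK kn bx im) // !eqxx.
move=> /back tm.
rewrite (bigID (cell (row_len m))) /=; congr (_ * _).
  apply: eq_big => [p|p /andP[cl cm]].
    by apply: andb_idl; apply: interlaced_cell.
  by rewrite ffunE cm andbF.
rewrite (eq_bigr (fun=> x k)) => [|p /andP[cl ncm]]; last first.
  by rewrite ffunE cl ncm /= inordK ?ltnS.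
rewrite prodr_const; congr (_ ^+ _).
rewrite -(card_cells bx) -(card_cells bm).
rewrite -(cardID (cell (row_len m)) [pred p | cell la p]).
rewrite [X in (X + _ - _)%N](_ : _ = #|[pred p : 'I_r * 'I_c | cell (row_len m) p]|).
  by rewrite addKn; apply: eq_card => p; rewrite !inE /= andbC.
apply: eq_card => p; rewrite !inE /=; apply: andb_idl.
exact: interlaced_cell.
Qed.

Lemma tabsum0 la : in_box D r c la -> tabsum 0 la = gtsum D 0 la x.
Proof.
move=> bx; have [[_ lD] dl l0 lc] := bx; rewrite /tabsum /=.
case: forallP => [z|nz].
  have la0 i : la i = 0%N.
    case: (leqP i D) => [iD|/lD //].
    by have /eqP := z (inord i); rewrite inordK.
  rewrite (big_pred1 [ffun=> ord0]) => [|t].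
    by rewrite big_pred0 // => p; rewrite /cell la0.
  apply/tableau_belowP/eqP => [[_ _ out _]|->].
    by apply/ffunP => p; rewrite ffunE out // /cell la0.
  by split=> // [p q|p q|p|p]; rewrite /cell ?la0 // ffunE.
rewrite big_pred0 // => t; apply/negP => /tableau_belowP[_ _ _ ub].
case: nz => i; apply/negPn/negP => nz.
have ir : (i < r)%N by rewrite ltnNge; apply/negP => /l0 e; rewrite e eqxx in nz.
have jc : (0 < c)%N by apply: leq_trans (lc i); rewrite lt0n.
by have := ub (Ordinal ir, Ordinal jc); rewrite /cell /= lt0n => /(_ nz).
Qed.

Lemma tabsum_gtsum k la : (k <= n.+1)%N -> in_box D r c la ->
  tabsum k la = gtsum D k la x.
Proof.
elim: k la => [|k IH] la kn bx; first exact: tabsum0.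
rewrite tabsum_step //=; apply: eq_bigr => m im.
rewrite IH //; [exact: ltnW|exact: in_box_interlaced im].
Qed.

End TableauSum.

(** * Schur polynomials as Gelfand-Tsetlin sums *)

Lemma nth_sorted_geq (s : seq nat) i : sorted geq s -> (nth 0 s i.+1 <= nth 0 s i)%N.
Proof.
move=> ss; case: (ltnP i.+1 (size s)) => [lt|ge]; last by rewrite nth_default.
by have /(sortedP 0%N)/(_ i lt) := ss.
Qed.

Lemma in_box_nth D (la : seq nat) : sorted geq la ->
  (size la <= D)%N -> (head 0%N la <= D)%N ->
  in_box D (size la) (head 0%N la) (nth 0%N la).
Proof.
move=> sla sD hD.
have dl i := nth_sorted_geq i sla.
have hd i : (nth 0 la i <= head 0 la)%N by rewrite -nth0; apply: nonincr_le.
split=> //; last by move=> i; apply: nth_default.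
split=> i; first exact: leq_trans (hd i) hD.
by move=> Di; rewrite nth_default // ltnW // (leq_ltn_trans sD).
Qed.

Lemma mmap_schur (R : comNzRingType) n (la : seq nat) (h : 'I_n -> R) :
  mmap intr h (schur n la) = \sum_(t | @ssyt la n t) \prod_(p | incell la p) h (t p).
Proof.
rewrite /schur raddf_sum; apply: eq_bigr => t _.
rewrite /= rmorph_prod; apply: eq_bigr => p _.
by rewrite /= mmapX mmap1U.
Qed.

Lemma schur_nil n : schur n [::] = 1.
Proof.
rewrite /schur; have t0 : {ffun 'I_(size (nil : seq nat)) * 'I_(head 0%N nil) -> 'I_n}.
  by apply: finfun => -[[]].
rewrite (big_pred1 t0) => [|t]; first by rewrite big_pred0 // => -[[]].
rewrite /= (_ : t = t0) ?eqxx; last by apply/ffunP => -[[]].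
by apply/andP; split; apply/forallP => -[[]].
Qed.

(** Iterated branching. Its tableaux take values in the nonempty type ['I_n.+1], so [n = 0] is
    handled apart, for the empty sequence. *)
Lemma schur_gtsum D (R : comNzRingType) n (la : seq nat) (x : nat -> R) :
  sorted geq la -> (size la <= D)%N -> (head 0%N la <= D)%N ->
  (0 < n)%N || nilp la ->
  mmap intr (fun i : 'I_n => x i) (schur n la) = gtsum D n (nth 0%N la) x.
Proof.
move=> sla sD hD; case: n => [|n].
  case/orP => // /nilP ->; rewrite schur_nil rmorph1.
  rewrite (_ : nth _ _ = fun=> 0%N) ?gtsum_empty //.
  by apply: functional_extensionality => -[].
move=> _; rewrite mmap_schur -(@tabsum_gtsum D n (size la) (head 0%N la)) //.
- rewrite /tabsum; apply: eq_bigl => t; rewrite /tableau_below /ssyt -[LHS]andbT.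
  by congr (_ && _); apply/esym/forallP => p; rewrite ltn_ord implybT.
- exact: leqW.
- exact: in_box_nth.
Qed.

(** * Leading monomials and Schur expansions *)

Section MonomialSums.
Variable n : nat.

Lemma ltmc_mnm1 (i j : 'I_n) : (i < j)%N -> (U_(j)%MM < U_(i)%MM)%O.
Proof.
move=> ij; apply/ltmcP; first by rewrite !mdeg1.
exists i => [k ki|]; rewrite !mnm1E.
  by rewrite !eqE /= !gtn_eqF //; lia.
by rewrite eqxx eqE /= gtn_eqF.
Qed.

Lemma lemc_mnm1 (i j : 'I_n) : (i <= j)%N -> (U_(j)%MM <= U_(i)%MM)%O.
Proof.
by rewrite leq_eqVlt => /orP[/eqP/val_inj -> //|/ltmc_mnm1/ltW].
Qed.

Lemma lemc_sum_mnm1 (T : finType) (P : pred T) (a b : T -> 'I_n) :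
  (forall p, P p -> (a p <= b p)%N) ->
  ((\sum_(p | P p) U_(b p))%MM <= (\sum_(p | P p) U_(a p))%MM)%O.
Proof.
move=> ab; elim/big_ind2: _ => [//|x1 x2 y1 y2|p Pp]; first exact: lem_add.
exact/lemc_mnm1/ab.
Qed.

(** A single index where [b] exceeds [a] would make the left monomial strictly smaller, the order
    being compatible with addition. *)
Lemma sum_mnm1_inj (T : finType) (P : pred T) (a b : T -> 'I_n) :
  (forall p, P p -> (a p <= b p)%N) ->
  (\sum_(p | P p) U_(b p))%MM = (\sum_(p | P p) U_(a p))%MM ->
  forall p, P p -> b p = a p.
Proof.
move=> ab e p Pp; apply/eqP; case: eqP => // /eqP ne.
have lt : (a p < b p)%N by rewrite ltn_neqAle ab // andbT eq_sym.
suff : ((\sum_(p | P p) U_(b p))%MM < (\sum_(p | P p) U_(a p))%MM)%O.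
  by rewrite e ltxx.
rewrite (bigD1 p) // [X in (_ < X)%O](bigD1 p) //=.
apply: ltmc_le_add; first exact: ltmc_mnm1.
by apply: lemc_sum_mnm1 => q /andP[Pq _]; apply: ab.
Qed.

End MonomialSums.

(** Among the indices with nonzero coefficient take one with largest [e i]. No other summand with
    nonzero coefficient contains the monomial [e i], so [a i] itself would be zero. *)
Lemma leading_independent (I : finType) (P : pred I) n (R : nzRingType)
    (e : I -> 'X_{1..n}) (p : I -> {mpoly R[n]}) (a : I -> R) :
  {in P &, injective e} ->
  (forall i, P i -> (p i)@_(e i) = 1) ->
  (forall i m, P i -> (p i)@_m != 0 -> (m <= e i)%O) ->
  \sum_(i | P i) a i *: p i = 0 -> forall i, P i -> a i = 0.
Proof.
move=> einj lc lm s0 i0 P0; apply/eqP; apply/negPn/negP => a0.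
have Q0 : P i0 && (a i0 != 0) by rewrite P0.
case: (@arg_maxP _ _ _ _ (fun i => P i && (a i != 0)) e Q0) => i /andP[Pi ai] imax.
have := congr1 (mcoeff (e i)) s0; rewrite raddf_sum mcoeff0 (bigD1 i) //=.
rewrite mcoeffZ lc // mulr1 big1 => [|j /andP[Pj ji]]; first by rewrite addr0; apply/eqP.
rewrite mcoeffZ; case: (eqVneq (a j) 0) => [->|aj]; first by rewrite mul0r.
case: (eqVneq (p j)@_(e i) 0) => [->|pj]; first by rewrite mulr0.
case/eqP: ji; apply: einj => //; apply/le_anti.
by apply/andP; split; [apply: imax; rewrite Pj|apply: lm].
Qed.

Section SchurLeading.
Variable la : seq nat.
Hypothesis sla : sorted geq la.

(** The content of the tableau whose row [i] is filled with [i]; it turns out to be the leading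
    exponent of [schur n la] once [size la <= n]. *)
Definition row_mnm n : 'X_{1..n} := [multinom nth 0%N la i | i < n].

Definition tab_mnm n (t : {ffun 'I_(size la) * 'I_(head 0%N la) -> 'I_n}) : 'X_{1..n} :=
  (\sum_(p | incell la p) U_(t p))%MM.

Lemma schurE n : schur n la = \sum_(t | @ssyt la n t) 'X_[tab_mnm t].
Proof.
by apply: eq_bigr => t _; rewrite mprodXE.
Qed.

Lemma card_incell :
  #|[pred p : 'I_(size la) * 'I_(head 0%N la) | incell la p]| = sumn la.
Proof.
pose D := (size la + head 0%N la)%N.
rewrite [LHS](@card_cells D (size la) (head 0%N la) _ (nth 0%N la)).
- rewrite (@weight_supp D (size la)); first by rewrite sumnE [RHS](big_nth 0%N) big_mkord.
    by rewrite leqW // leq_addr.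
  by move=> i; apply: nth_default.
- by rewrite leqW // leq_addr.
- by apply: in_box_nth; rewrite // ?leq_addr ?leq_addl.
Qed.

Lemma schur_homog n : schur n la \is (sumn la).-homog.
Proof.
rewrite schurE; apply: rpred_sum => t _; rewrite dhomogX /tab_mnm.
rewrite /= mdeg_sum (eq_bigr (fun=> 1%N)) => [|p _]; last by rewrite mdeg1.
by rewrite sum1_card -card_incell.
Qed.

(** Columns strictly increase from at least 0. Hence the tableau with row [i] filled with [i] is
    entrywise minimal, and its monomial maximal. *)
Lemma ssyt_row_le n (t : {ffun 'I_(size la) * 'I_(head 0%N la) -> 'I_n}) p :
  ssyt t -> incell la p -> (p.1 <= t p)%N.
Proof.
move=> /andP[/forallP h _]; case: p => -[i ir] j /=.
elim: i ir => // i IH ir cp; have ir' := ltnW ir.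
have cq : incell la (Ordinal ir', j) by apply: leq_trans cp _; apply: nth_sorted_geq.
have /forallP/(_ (Ordinal ir, j)) := h (Ordinal ir', j).
rewrite cq cp /= eqxx ltnSn /= => /andP[_ lt].
exact: leq_ltn_trans (IH ir' cq) lt.
Qed.

Section Fits.
Variable n : nat.
Hypothesis sn : (size la <= n)%N.

Lemma row_mnmE :
  row_mnm n = (\sum_(p : 'I_(size la) * 'I_(head 0%N la) | incell la p)
     U_(widen_ord sn p.1))%MM.
Proof.
apply/mnmP => i; rewrite mnmE mnm_sumE.
rewrite -(pair_big_dep xpredT (fun r (j : 'I_(head 0%N la)) => incell la (r, j))
  (fun r _ => U_(widen_ord sn r)%MM i)) /=.
have hd j : (nth 0 la j <= head 0 la)%N.
  by rewrite -nth0; apply: nonincr_le => // k; apply: nth_sorted_geq.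
transitivity (\sum_(r < size la) (nth 0 la r) * (r == i :> nat))%N; last first.
  apply: eq_bigr => r _; rewrite mnm1E (eqE (widen_ord _ _)) /=.
  by rewrite -(big_ord_widen _ (fun=> nat_of_bool (r == i :> nat)) (hd r))
     sum_nat_const card_ord.
case: (ltnP i (size la)) => [ir|ri].
  rewrite (bigD1 (Ordinal ir)) //= eqxx muln1 big1 ?addn0 // => r.
  by rewrite eqE /= => /negbTE ->; rewrite muln0.
rewrite nth_default // big1 // => r _.
by rewrite ltn_eqF ?muln0 //; apply: leq_trans ri.
Qed.

Lemma schur_supp_le m : (schur n la)@_m != 0 -> (m <= row_mnm n)%O.
Proof.
rewrite schurE raddf_sum /= => nz.
have /exists_inP [t st /eqP <-] : [exists (t | @ssyt la n t), tab_mnm t == m].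
  apply: contraNT nz; rewrite negb_exists_in => /forall_inP h.
  by rewrite big1 // => t st; rewrite mcoeffX (negbTE (h t st)).
rewrite row_mnmE; apply: lemc_sum_mnm1 => p cp /=; exact: ssyt_row_le.
Qed.
End Fits.

(** Any tableau with this content is entrywise at least the row-constant tableau [t0], hence equal
    to it by [sum_mnm1_inj]. *)
Lemma schur_row_coeff n : (size la <= n)%N -> (schur n la)@_(row_mnm n) = 1.
Proof.
case: n => [|n] sn.
  have -> : la = [::] by apply/nilP; rewrite /nilp -leqn0.
  rewrite schur_nil mcoeff1 (_ : _ == _) //; apply/eqP/mnmP; case=> //.
pose t0 : {ffun 'I_(size la) * 'I_(head 0%N la) -> 'I_n.+1} :=
  [ffun p => if incell la p then widen_ord sn p.1 else ord0].
rewrite schurE raddf_sum /= (bigD1 t0) /=; last first.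
  apply/andP; split.
    apply/forallP => p; apply/forallP => q; apply/implyP => /andP[cp cq].
    rewrite !ffunE cp cq /=; apply/andP; split; apply/implyP => /andP[/eqP e l] //.
    by rewrite e.
  by apply/forallP => p; apply/implyP => /negbTE ncp; rewrite ffunE ncp.
rewrite mcoeffX (row_mnmE sn) (_ : tab_mnm t0 == _); last first.
  by apply/eqP; apply: eq_bigr => p cp; rewrite ffunE cp.
rewrite big1 ?addr0 // => t /andP[st nt]; rewrite mcoeffX.
case: eqP => // e; case/eqP: nt; apply/ffunP => p; rewrite ffunE.
case: ifP => cp.
  apply: (sum_mnm1_inj _ e) => // q cq; exact: ssyt_row_le.
have /andP[_ /forallP/(_ p)] := st; rewrite cp /= => /eqP e0.
exact/val_inj.
Qed.

Lemma mmap_schurX n : mmap intr (fun i : 'I_n => 'X_i) (schur n la) = schur n la.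
Proof. by rewrite mmap_schur. Qed.

End SchurLeading.

(** * Symmetry under adjacent transpositions *)

Definition adj_symmetric n (R : nzRingType) (p : {mpoly R[n]}) :=
  forall i j : 'I_n, i.+1 = j :> nat -> msym (tperm i j) p = p.

(** Were the exponent at [i] smaller than at [i.+1], exchanging the two would give a larger
    monomial, still in the support by symmetry. *)
Lemma adj_symmetric_mlead n (R : nzRingType) (p : {mpoly R[n]}) : adj_symmetric p ->
  forall i j : 'I_n, (i <= j)%N -> (mlead p j <= mlead p i)%N.
Proof.
move=> sp; have [->|nz] := eqVneq p 0; first by move=> i j _; rewrite mlead0 !mnm0E.
(* The exponents are extended by 0 to all natural indices, so that only consecutive indices need
   comparing. *)
pose f k := oapp (mlead p : 'I_n -> nat) 0%N (insub k).
have fE (i : 'I_n) : f i = mlead p i by rewrite /f valK.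
move=> i j ij; rewrite -!fE; apply: nonincr_le => // {i j ij} k.
rewrite {1}/f; case: insubP => [j _ jk|_] //=.
have {}jk : nat_of_ord j = k.+1 by [].
have kn : (k < n)%N by apply: ltnW; rewrite -jk ltn_ord.
pose i := Ordinal kn; rewrite -[k]/(nat_of_ord i) fE.
have ij : i.+1 = j :> nat by rewrite jk.
rewrite leqNgt; apply/negP => lt.
pose m := [multinom mlead p (tperm i j l) | l < n].
have : m \in msupp p by rewrite mcoeff_msupp -mcoeff_sym sp // mleadc_eq0.
move/msupp_le_mlead; apply/negP; rewrite -ltNge.
apply/ltmcP; first by rewrite mdeg_mperm.
exists i => [l li|]; last by rewrite mnmE tpermL.
by rewrite mnmE tpermD // eqE /= gtn_eqF //; rewrite -?ij; apply: (leq_trans li).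
Qed.

Lemma schur_adj_symmetric n la : sorted geq la -> adj_symmetric (schur n la).
Proof.
move=> sla i j ij; have n0 : (0 < n)%N by apply: leq_trans (ltn_ord i).
(* Permuting the variables amounts to evaluating the Gelfand-Tsetlin sum at the permuted variables,
   indexed here by natural numbers with default value 0 past [n]. *)
pose X (s : 'S_n) k : {mpoly int[n]} := oapp (fun l : 'I_n => 'X_(s l)) 0 (insub k).
have XE s (l : 'I_n) : X s l = 'X_(s l) by rewrite /X valK.
pose D := (size la + head 0%N la)%N.
have gE s : msym s (schur n la) = gtsum D n (nth 0%N la) (X s).
  rewrite -schur_gtsum // ?leq_addr ?leq_addl ?n0 // mmap_schur.
  rewrite /schur raddf_sum; apply: eq_bigr => t _.
  rewrite /= rmorph_prod; apply: eq_bigr => p _; rewrite XE.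
  by rewrite /= /msym mmapX mmap1U.
have [fl _ _ _] : in_box D (size la) (head 0%N la) (nth 0%N la).
  by apply: in_box_nth; rewrite // ?leq_addr ?leq_addl.
rewrite -[RHS]msym1m !gE -(@gtsum_swap D _ i n _ (X 1%g)) ?ij //.
apply: eq_gtsum => k kn; pose l := Ordinal kn; rewrite -[k]/(nat_of_ord l).
rewrite /swap_var ij !XE !perm1.
case: (eqVneq l i) => [->|li]; first by rewrite eqxx tpermL.
case: (eqVneq l j) => [->|lj]; first by rewrite -{1}ij gtn_eqF // eqxx tpermR.
by rewrite !(inj_eq val_inj) (negbTE li) (negbTE lj) tpermD // eq_sym.
Qed.

(** * Partitions indexing a Schur expansion *)

Lemma nth_strip s i : sorted geq s -> nth 0%N (strip s) i = nth 0%N s i.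
Proof.
rewrite /strip; elim: s i => // x s IH i /= pxs.
have ss := path_sorted pxs; case: ifP => [x0|/negbT]; first by case: i => //= i; apply: IH.
rewrite -eqn0Ngt => /eqP x0; rewrite x0 in pxs.
rewrite IH //; move: pxs; rewrite path_sortedE; last first.
  by move=> a b c /= ba ac; apply: leq_trans ba.
case/andP => /allP h _.
have z k : nth 0%N s k = 0%N.
  case: (ltnP k (size s)) => [lt|ge]; last exact: nth_default.
  by apply/eqP; rewrite -leqn0; apply/h/mem_nth.
by rewrite z; case: i => //= k; rewrite z.
Qed.

Lemma sorted_strip s : sorted geq s -> sorted geq (strip s).
Proof. by apply: sorted_filter => a b c /= ba ac; apply: leq_trans ba. Qed.

Section Parts.
Variable d : nat.
Implicit Type nu : {ffun 'I_d -> 'I_d.+1}.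

Lemma ispart_sorted nu : ispart nu -> sorted geq [seq (nu i : nat) | i <- enum 'I_d].
Proof.
case/andP => /forallP h _; apply/(sortedP 0%N) => i; rewrite size_map size_enum_ord => lt.
have E (k : 'I_d) : nth 0%N [seq (nu i : nat) | i <- enum 'I_d] k = nu k.
  by rewrite (nth_map k) ?size_enum_ord // nth_ord_enum.
have := E (Ordinal lt); have := E (Ordinal (ltnW lt)); rewrite /= => -> ->.
by have /forallP/(_ (Ordinal lt)) := h (Ordinal (ltnW lt)); rewrite /= leqnSn.
Qed.

Lemma nth_part_of nu (i : 'I_d) : ispart nu -> nth 0%N (part_of nu) i = nu i.
Proof.
move=> pn; rewrite nth_strip ?ispart_sorted // (nth_map i) ?size_enum_ord //.
by rewrite nth_ord_enum.
Qed.

Lemma size_part_of nu : (size (part_of nu) <= d)%N.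
Proof.
rewrite /part_of /strip size_filter; apply: leq_trans (count_size _ _) _.
by rewrite size_map size_enum_ord.
Qed.

Lemma part_of_sorted nu : ispart nu -> sorted geq (part_of nu).
Proof. by move=> pn; apply/sorted_strip/ispart_sorted. Qed.

Lemma part_of_inj : {in [pred nu | ispart nu] &, injective (@part_of d d)}.
Proof.
move=> nu nu' pn pn' e; apply/ffunP => i; apply/val_inj.
by rewrite /= -!nth_part_of // e.
Qed.

Lemma sumn_part_of nu : ispart nu -> sumn (part_of nu) = d.
Proof.
case/andP => _ /eqP e; rewrite -[RHS]e.
rewrite /part_of /strip sumnE big_filter big_mkcond big_map big_enum /=.
by apply: eq_bigr => i _; case: (nat_of_ord _).
Qed.

Lemma schur_part_homog nu : ispart nu -> schur d (part_of nu) \is d.-homog.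
Proof.
by move=> pn; have := schur_homog (part_of_sorted pn) d; rewrite sumn_part_of.
Qed.

(** Induction on the leading monomial: by symmetry and homogeneity its exponent is a partition [nu]
    of [d], and subtracting the matching multiple of the Schur polynomial of [nu] lowers it. *)
Lemma adj_symmetric_expansion (p : {mpoly int[d]}) :
  p \is d.-homog -> adj_symmetric p ->
  exists a : {ffun 'I_d -> 'I_d.+1} -> int,
    p = \sum_(nu | ispart nu) a nu *: schur d (part_of nu).
Proof.
elim/mleadrect: p => p IH hp sp.
have [->|nz] := eqVneq p 0.
  by exists (fun=> 0); rewrite big1 // => nu _; rewrite scale0r.
have dm : mdeg (mlead p) = d by apply: (dhomog_mf hp); apply: mlead_supp.
have le_d i : (mlead p i < d.+1)%N.
  by rewrite ltnS -[X in (_ <= X)%N]dm mdegE (bigD1 i) //= leq_addr.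
pose nu : {ffun 'I_d -> 'I_d.+1} := [ffun i => Ordinal (le_d i)].
have pn : ispart nu.
  apply/andP; split.
    apply/forallP => i; apply/forallP => j; apply/implyP => ij; rewrite !ffunE /=.
    exact: adj_symmetric_mlead.
  apply/eqP; rewrite -[RHS]dm mdegE; apply: eq_bigr => i _; by rewrite ffunE.
have rm : row_mnm (part_of nu) d = mlead p.
  by apply/mnmP => i; rewrite mnmE nth_part_of // ffunE.
have so := part_of_sorted pn.
pose q := p - mleadc p *: schur d (part_of nu).
have hq : q \is d.-homog by rewrite rpredB // rpredZ // schur_part_homog.
have sq : adj_symmetric q.
  move=> i j ij; rewrite /q raddfB /= msymZ sp //.
  by rewrite (schur_adj_symmetric so).
have qlead : q@_(mlead p) = 0.
  rewrite /q mcoeffB mcoeffZ -[X in (schur _ _)@_X]rm.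
  by rewrite schur_row_coeff ?size_part_of // mulr1 subrr.
have [a qE] : exists a : {ffun 'I_d -> 'I_d.+1} -> int,
    q = \sum_(nu | ispart nu) a nu *: schur d (part_of nu).
  have [->|nzq] := eqVneq q 0.
    by exists (fun=> 0); rewrite big1 // => nu' _; rewrite scale0r.
  apply: IH => //; rewrite lt_neqAle; apply/andP; split.
    by apply: contraNneq nzq => e; rewrite -mleadc_eq0 e qlead.
  (* A monomial of [q] comes from [p] or from the subtracted Schur polynomial, and [mlead p] bounds
     the support of both. *)
  have := mlead_supp nzq; rewrite mcoeff_msupp {1}/q mcoeffB mcoeffZ.
  case: (eqVneq p@_(mlead q) 0) => [->|ne _]; last first.
    by apply: msupp_le_mlead; rewrite mcoeff_msupp.
  rewrite sub0r oppr_eq0 mulf_eq0 negb_or => /andP[_].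
  by move/(schur_supp_le so (size_part_of nu)); rewrite rm.
exists (fun nu' => a nu' + mleadc p *+ (nu' == nu)).
under eq_bigr => nu' _ do rewrite scalerDl.
rewrite big_split /= -qE [X in _ = _ + X](bigD1 nu) //= eqxx mulr1n.
rewrite [X in _ + (_ + X)]big1 ?addr0 ?subrK // => nu' /andP[_ /negbTE ->].
by rewrite mulr0n scale0r.
Qed.

End Parts.

(** * Existence of Littlewood-Richardson expansions *)

Lemma prod_schur_homog n (ls : seq (seq nat)) :
  (forall la, la \in ls -> sorted geq la) ->
  \prod_(la <- ls) schur n la \is (sumn (map sumn ls)).-homog.
Proof.
elim: ls => [|la ls IH] sls; first by rewrite big_nil; apply: dhomog1.
rewrite big_cons /=; apply: dhomogM; first by apply: schur_homog; apply: sls; rewrite mem_head.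
by apply: IH => la' la'ls; apply: sls; rewrite in_cons la'ls orbT.
Qed.

Lemma lr_expansion_exists (ls : seq (seq nat)) :
  (forall la, la \in ls -> sorted geq la) -> exists c, lr_expansion ls c.
Proof.
move=> sls; rewrite /lr_expansion; set d := sumn _.
have [a aE] : exists a : {ffun 'I_d -> 'I_d.+1} -> int,
    \prod_(la <- ls) schur d la = \sum_(nu | ispart nu) a nu *: schur d (part_of nu).
  apply: adj_symmetric_expansion.
    exact: prod_schur_homog.
  move=> i j ij; rewrite rmorph_prod /=; rewrite [LHS]big_seq [RHS]big_seq.
  by apply: eq_bigr => la /sls sla; apply: schur_adj_symmetric.
(* Coefficients indexed by [nu] become a function of the sequence [part_of nu]; injectivity of
   [part_of] leaves a single term in the sum. *)
exists (fun s => \sum_(nu : {ffun 'I_d -> 'I_d.+1} | ispart nu && (part_of nu == s)) a nu).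
rewrite aE; apply: eq_bigr => nu pn; congr (_ *: _).
rewrite (big_pred1 nu) // => nu'; apply/andP/eqP => [[pn' /eqP e]|-> //].
exact: part_of_inj.
Qed.

(** Since an expansion exists, [epsilon] returns one, and [lrc] reads its values off it. The duality
    is proved below for any two expansions, whichever are chosen. *)
Lemma lrcP (ls : seq (seq nat)) : (forall la, la \in ls -> sorted geq la) ->
  exists2 c, lr_expansion ls c & forall mu, lrc ls mu = c (strip mu).
Proof.
move=> sls; pose c := epsilon (inhabits (fun _ : seq nat => 0 : int)) (lr_expansion ls).
exists c => //; exact: epsilon_spec (lr_expansion_exists sls).
Qed.

(** * Restriction to [N] variables and duality *)

Lemma schur_restrict D (R : comNzRingType) N n la (x : nat -> R) :
  sorted geq la -> (size la <= D)%N -> (head 0%N la <= D)%N ->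
  ((0 < n) && (N <= n))%N || nilp la ->
  mmap intr (fun i : 'I_n => if (i < N)%N then x i else 0) (schur n la) =
  gtsum D N (nth 0%N la) x.
Proof.
move=> sla sD hD cond.
have [fl dl _ _] := in_box_nth sla sD hD.
rewrite (@schur_gtsum D _ n la (fun i => if (i < N)%N then x i else 0)) //; last first.
  by case/orP: cond => [/andP[->]|->]; rewrite ?orbT.
case/orP: cond => [/andP[_ Nn]|/nilP ->].
  rewrite (@gtsum_trunc D _ N n) //; last by move=> i Ni; rewrite ltnNge Ni.
  by apply: eq_gtsum => i ->.
rewrite (_ : nth _ _ = fun=> 0%N) ?gtsum_empty //.
by apply: functional_extensionality => -[].
Qed.

Lemma head_le_sumn s : (head 0%N s <= sumn s)%N.
Proof. by case: s => //= a s; apply: leq_addr. Qed.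

(** The expansion is stated in [d] variables; sending those of index at least [N] to 0 and the
    others to the values of [x] gives an identity of sums in [N] variables. *)
Lemma lr_expansion_restrict D (R : comNzRingType) N (ls : seq (seq nat)) c (x : nat -> R)
    (d := sumn (map sumn ls)) :
  lr_expansion ls c -> (d <= D)%N -> (d == 0)%N || (N <= d)%N ->
  (forall la, la \in ls -> [/\ sorted geq la, (size la <= D)%N, (head 0%N la <= D)%N
     & d = 0%N -> la = [::]]) ->
  \prod_(la <- ls) gtsum D N (nth 0%N la) x =
  \sum_(nu : {ffun 'I_d -> 'I_d.+1} | ispart nu)
     (c (part_of nu))%:~R * gtsum D N (nth 0%N (part_of nu)) x.
Proof.
move=> ce dD Nd hls.
have cond la : (d = 0%N -> la = [::]) -> ((0 < d) && (N <= d))%N || nilp la.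
  by move=> h; case: posnP Nd => [/h ->|_ /=]; rewrite ?orbT // => ->.
pose h (i : 'I_d) : R := if (i < N)%N then x i else 0.
have := congr1 (mmap intr h) ce; rewrite rmorph_prod raddf_sum /= => e.
rewrite big_seq (eq_bigr (fun la => mmap intr h (schur d la))) => [|la /hls[sla sD hD l0]].
  rewrite -big_seq [LHS]e; apply: eq_bigr => nu pn; rewrite /= mmapZ; congr (_ * _).
  apply: schur_restrict.
  - exact: part_of_sorted.
  - exact: leq_trans (size_part_of nu) dD.
  - by apply: leq_trans dD; rewrite -[X in (_ <= X)%N](sumn_part_of pn) head_le_sumn.
  - by apply: cond => d0; apply/nilP; rewrite /nilp -leqn0 -d0 size_part_of.
by rewrite /h (@schur_restrict D) //; apply: cond.
Qed.

Definition shift_rows (b N : nat) (la : nat -> nat) (i : nat) : nat :=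
  if (i < N)%N then (b + la i)%N else 0%N.

(** Two successive complements, of width [B] and then [b + B], prepend [b] columns of height [N]; of
    the two powers of the product of the variables, the exponent [b] remains. *)
Lemma gtsum_shift D (F : fieldType) N b la (x : nat -> F) (B : nat) :
  (N <= D.+1)%N -> (b + B <= D)%N -> (forall i, la i <= B)%N ->
  (forall i, N <= i -> la i = 0)%N -> (forall i, (i < N)%N -> x i != 0) ->
  gtsum D N (shift_rows b N la) x = (\prod_(i < N) x i) ^+ b * gtsum D N la x.
Proof.
move=> ND BD lB l0 x0.
have BD' : (B <= D)%N by apply: leq_trans BD; apply: leq_addl.
have fl : fits D la.
  by split=> i; [apply: leq_trans (lB i) BD' | move=> Di; apply: l0; apply: leq_trans Di].
have -> : shift_rows b N la = box_compl (b + B) N (box_compl B N la).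
  apply: functional_extensionality => i; rewrite /shift_rows /box_compl.
  case: ifP => // iN; rewrite ifT; last by lia.
  have -> : (N.-1 - (N.-1 - i) = i)%N by lia.
  by have := lB i; lia.
have P0 : \prod_(i < N) x i != 0 by apply/prodf_neq0 => i _; apply: x0.
rewrite gtsum_compl //; first last.
- by move=> i Ni; rewrite /box_compl ltnNge Ni.
- by move=> i; rewrite /box_compl; case: ifP => //; lia.
- exact: box_compl_fits.
rewrite gtsum_compl //; last by move=> i iN; rewrite invr_eq0 x0.
rewrite mulrA prodfV exprD exprVn mulfK ?expf_neq0 //; congr (_ * _).
by apply: eq_gtsum => i _; rewrite invrK.
Qed.

(** * Linear independence of Schur polynomials in [N] variables *)

Section Uniqueness.
Variables (D N : nat).
Hypothesis ND : (N <= D)%N.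

Definition mvar (i : nat) : {mpoly int[N]} := oapp (fun j : 'I_N => 'X_j) 0 (insub i).

(** Partitions with at most [N] parts: their Schur polynomials in [N] variables have distinct
    leading exponents. *)
Definition good_shape (m : bshape D) : bool :=
  sorted geq (mkseq (row_len m) N) &&
  [forall i : 'I_D.+1, (N <= i)%N ==> (row_len m i == 0%N)].

Lemma good_shapeP m : good_shape m ->
  sorted geq (mkseq (row_len m) N) /\ forall i, (N <= i)%N -> row_len m i = 0%N.
Proof.
case/andP => ss /forallP h; split=> // i Ni.
case: (leqP i D) => [iD|Di]; last exact: (proj2 (fits_row_len m)).
by have := h (inord i); rewrite inordK ?ltnS // Ni => /eqP.
Qed.

Lemma nth_good_shape m : good_shape m -> nth 0%N (mkseq (row_len m) N) = row_len m.
Proof.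
case/good_shapeP => _ m0; apply: functional_extensionality => i.
case: (ltnP i N) => iN; first by rewrite nth_mkseq.
by rewrite nth_default ?size_mkseq // m0.
Qed.

Lemma good_shape_of f : (forall i, f i.+1 <= f i)%N -> (forall i, f i <= D)%N ->
  (forall i, N <= i -> f i = 0)%N -> row_len (shape_of D f) = f /\ good_shape (shape_of D f).
Proof.
move=> df fD f0; have ff : fits D f.
  by split=> // i Di; apply: f0; apply: leq_trans ND (ltnW Di).
rewrite shape_ofK //; split=> //; rewrite /good_shape shape_ofK //; apply/andP; split.
  apply/(sortedP 0%N) => i; rewrite size_mkseq => lt.
  by rewrite !nth_mkseq ?(ltnW lt) //; apply: df.
by apply/forallP => i; apply/implyP => /f0 ->.
Qed.

Lemma gtsum_good_shape m : (0 < N)%N -> good_shape m ->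
  gtsum D N (row_len m) mvar = schur N (mkseq (row_len m) N).
Proof.
move=> N0 gm; have [sm m0] := good_shapeP gm.
rewrite -[RHS]mmap_schurX -{1}(nth_good_shape gm) -schur_gtsum ?size_mkseq ?N0 //.
  rewrite !mmap_schur; apply: eq_bigr => t _; apply: eq_bigr => p _.
  by rewrite /mvar valK.
by rewrite -nth0 nth_good_shape //; case: (fits_row_len m).
Qed.

(** Terms are grouped by shape, and the Schur polynomials of good shapes are independent by their
    leading monomials. Two index types allow expansions over partitions of different sizes to be
    compared. *)
Lemma gtsum_coef_unique (J J' : finType) (Q : pred J) (Q' : pred J')
    (sh : J -> bshape D) (sh' : J' -> bshape D) (a : J -> int) (a' : J' -> int) :
  (0 < N)%N ->
  (forall j, Q j -> good_shape (sh j)) -> (forall j, Q' j -> good_shape (sh' j)) ->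
  \sum_(j | Q j) a j *: gtsum D N (row_len (sh j)) mvar =
    \sum_(j | Q' j) a' j *: gtsum D N (row_len (sh' j)) mvar ->
  forall m, good_shape m ->
    \sum_(j | Q j && (sh j == m)) a j = \sum_(j | Q' j && (sh' j == m)) a' j.
Proof.
move=> N0 gs gs' e m gm.
have group (J0 : finType) (P : pred J0) (s : J0 -> bshape D) (b : J0 -> int) :
    (forall j, P j -> good_shape (s j)) ->
    \sum_(j | P j) b j *: gtsum D N (row_len (s j)) mvar =
    \sum_(i | good_shape i) (\sum_(j | P j && (s j == i)) b j) *:
       schur N (mkseq (row_len i) N).
  move=> g; rewrite (partition_big s good_shape) //; apply: eq_bigr => i gi.
  rewrite scaler_suml; apply: eq_bigr => j /andP[Pj /eqP ->].
  by rewrite gtsum_good_shape.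
apply/eqP; rewrite -subr_eq0; apply/eqP; move: m gm.
apply: (@leading_independent _ _ N _ (fun i => row_mnm (mkseq (row_len i) N) N)
  (fun i => schur N (mkseq (row_len i) N))).
- move=> i i' gi gi' ei; rewrite -[i]row_lenK -[i']row_lenK; congr shape_of.
  apply: functional_extensionality => k; case: (ltnP k N) => kN; last first.
    by rewrite (proj2 (good_shapeP gi)) // (proj2 (good_shapeP gi')).
  have /mnmP/(_ (Ordinal kN)) := ei.
  by rewrite !mnmE !nth_good_shape.
- move=> i gi; apply: schur_row_coeff; last by rewrite size_mkseq.
  by case: (good_shapeP gi).
- move=> i mm gi; apply: schur_supp_le; last by rewrite size_mkseq.
  by case: (good_shapeP gi).
under eq_bigr => i _ do rewrite scalerBl.
by rewrite big_split /= sumrN -!group // e subrr.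
Qed.

End Uniqueness.

(** * Rectangular partitions *)

Lemma eq_strip s s' : sorted geq s -> sorted geq s' ->
  nth 0%N s =1 nth 0%N s' -> strip s = strip s'.
Proof.
move=> ss ss' e.
(* All entries of a stripped sequence are positive, so its length can be read off [nth]. *)
have pos (u : seq nat) i : (i < size (strip u))%N = (0 < nth 0 (strip u) i)%N.
  case: ltnP => lt; last by rewrite nth_default.
  by have := mem_nth 0%N lt; rewrite {2}/strip mem_filter => /andP[->].
have e' i : nth 0%N (strip s) i = nth 0%N (strip s') i by rewrite !nth_strip.
apply: (@eq_from_nth _ 0%N) => // .
apply/eqP; rewrite eqn_leq; apply/andP; split; rewrite leqNgt; apply/negP.
  by rewrite pos e' -pos ltnn.
by rewrite pos -e' -pos ltnn.
Qed.

Lemma sorted_nseq k (a : nat) : sorted geq (nseq k a).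
Proof.
apply/(sortedP 0%N) => i; rewrite size_nseq => lt.
by rewrite !nth_nseq lt (ltnW lt) /=.
Qed.

Lemma part_of_mono d (nu : {ffun 'I_d -> 'I_d.+1}) i j : ispart nu -> (i <= j)%N ->
  (nth 0 (part_of nu) j <= nth 0 (part_of nu) i)%N.
Proof. by move=> pn; apply: nonincr_le => k; apply/nth_sorted_geq/part_of_sorted. Qed.

Lemma part_of_le d (nu : {ffun 'I_d -> 'I_d.+1}) i : ispart nu ->
  (nth 0 (part_of nu) i <= d)%N.
Proof.
move=> pn; apply: leq_trans (part_of_mono pn (leq0n i)) _.
by rewrite nth0 -[X in (_ <= X)%N](sumn_part_of pn) head_le_sumn.
Qed.

Lemma part_of_supp d (nu : {ffun 'I_d -> 'I_d.+1}) N i : ispart nu ->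
  nth 0%N (part_of nu) N = 0%N -> (N <= i)%N -> nth 0%N (part_of nu) i = 0%N.
Proof. by move=> pn nN /(part_of_mono pn); rewrite nN leqn0 => /eqP. Qed.

Lemma rect_part_of N M d (nu : {ffun 'I_d -> 'I_d.+1}) : ispart nu ->
  (forall i, nth 0 (part_of nu) i = if i < N then M else 0)%N ->
  part_of nu = strip (nseq N M).
Proof.
move=> pn e; rewrite -[LHS]filter_id.
apply: eq_strip => [||i]; [exact: part_of_sorted|exact: sorted_nseq|].
by rewrite e nth_nseq.
Qed.

Lemma rect_part_exists N M d : (0 < N)%N -> d = (N * M)%N ->
  exists2 nu : {ffun 'I_d -> 'I_d.+1}, ispart nu &
    forall i, (nth 0 (part_of nu) i = if i < N then M else 0)%N.
Proof.
move=> N0 dE.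
have Md : (M <= d)%N by rewrite dE leq_pmull.
pose f i := (if i < N then M else 0)%N.
have fd i : (f i < d.+1)%N by rewrite /f; case: ifP.
pose nu : {ffun 'I_d -> 'I_d.+1} := [ffun i : 'I_d => Ordinal (fd i)].
have f_out i : (d <= i)%N -> f i = 0%N.
  rewrite /f dE; case: ifP => // iN Mi; apply/eqP; rewrite -leqn0 leqNgt; apply/negP => M0.
  by have := leq_pmulr N M0; lia.
have pn : ispart nu.
  apply/andP; split.
    apply/forallP => i; apply/forallP => j; apply/implyP => ij; rewrite !ffunE /= /f.
    by case: ifP => // jN; rewrite (leq_ltn_trans ij jN).
  apply/eqP; under eq_bigr => i _ do rewrite ffunE /=.
  (* When [M = 0], [d] is smaller than [N]; the range [N + d] contains both and can be cut down to
     either. *)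
  have -> : (\sum_(i < d) f i = \sum_(i < N + d) f i)%N.
    rewrite -!(big_mkord xpredT f) [RHS](big_cat_nat _ (leq_addl N d)) //=.
    rewrite [X in (_ + X)%N]big_nat_cond [X in (_ + X)%N]big1 ?addn0 //.
    by move=> i /andP[/andP[/f_out]].
  rewrite -(big_mkord xpredT f) (big_cat_nat _ (leq_addr d N)) //=.
  rewrite [X in (_ + X)%N]big_nat_cond [X in (_ + X)%N]big1 ?addn0; last first.
    by move=> i /andP[/andP[Ni _] _]; rewrite /f ltnNge Ni.
  rewrite big_mkord (eq_bigr (fun=> M)) ?sum_nat_const ?card_ord -?dE // => i _.
  by rewrite /f ltn_ord.
exists nu => // i; case: (ltnP i d) => id.
  by rewrite (nth_part_of (Ordinal id) pn) ffunE.
by rewrite nth_default -/(f i) ?f_out // (leq_trans (size_part_of nu)).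
Qed.

(** Evaluates a side of [gtsum_coef_unique] at a shape [m0] that [sh] takes only at the rectangle: a
    single partition contributes. *)
Lemma sum_over_rect N M d D (m0 : bshape D) (c : seq nat -> int)
    (sh : {ffun 'I_d -> 'I_d.+1} -> bshape D) :
  (0 < N)%N -> d = (N * M)%N ->
  (forall nu, ispart nu -> nth 0%N (part_of nu) N = 0%N ->
     (sh nu == m0) = [forall i : 'I_N, nth 0%N (part_of nu) i == M]) ->
  \sum_(nu | (ispart nu && (nth 0%N (part_of nu) N == 0%N)) && (sh nu == m0)) c (part_of nu)
  = c (strip (nseq N M)).
Proof.
move=> N0 dE shE; have [nu0 pn0 e0] := rect_part_exists N0 dE.
rewrite (big_pred1 nu0) => [|nu]; first by rewrite (rect_part_of pn0 e0).
apply/andP/eqP => [[/andP[pn /eqP nN] snu]|->]; last first.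
  rewrite pn0 e0 ltnn eqxx; split=> //; rewrite shE ?e0 ?ltnn //.
  by apply/forallP => i; rewrite e0 ltn_ord.
apply: part_of_inj => //; rewrite (rect_part_of pn0 e0); apply: rect_part_of => // i.
move: snu; rewrite shE // => /forallP h; case: ltnP => iN.
  by have /eqP := h (Ordinal iN).
exact: part_of_supp nN iN.
Qed.

Lemma box_compl_rect N l : (l <= N)%N ->
  box_compl N N (nth 0%N (nseq l N)) = nth 0%N (nseq (N - l) N).
Proof.
move=> lN; apply: functional_extensionality => i; rewrite /box_compl !nth_nseq.
by case: ifP => iN; case: (ltnP (N.-1 - i) l) => ?; case: (ltnP i (N - l)) => ?; lia.
Qed.

Lemma sumn_rect N (f : nat -> nat) (L : seq nat) :
  sumn (map sumn [seq nseq (f l) N | l <- L]) = (N * sumn (map f L))%N.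
Proof. by elim: L => [|l L /= ->]; rewrite ?muln0 //= sumn_nseq mulnDr. Qed.

Lemma sumn_compl N (L : seq nat) : all (fun l => l <= N)%N L ->
  (sumn [seq N - l | l <- L] = size L * N - sumn L)%N /\ (sumn L <= size L * N)%N.
Proof.
elim: L => [//|l L IH] /= /andP[lN /IH[e le]].
by rewrite e mulSn; split; lia.
Qed.

(** * Complementation of rectangles *)

Section RectangleDuality.
Variables (N : nat) (L : seq nat).
Hypotheses (N0 : (0 < N)%N) (LN : all (fun l => l <= N)%N L).
Let ls1 := [seq nseq l N | l <- L].
Let ls2 := [seq nseq (N - l) N | l <- L].
Let M := sumn L.
Let K := size L.
Let d1 := sumn (map sumn ls1).
Let d2 := sumn (map sumn ls2).
(** Large enough for [N] rows, for complements of width [K * N + d1], and for parts at most [d2]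
    shifted by [d1]. *)
Let D := (N + K * N + d1 + d2)%N.

(** Complementation inverts the variables, hence the fraction field. *)
Let F := {fraction {mpoly int[N]}}.
Let x (i : nat) : F := FracField.tofrac (mvar N i).
Let P : F := \prod_(i < N) x i.

Let x_neq0 i : (i < N)%N -> x i != 0.
Proof.
move=> iN; rewrite /x /mvar insubT /= tofrac_eq0 -msupp_eq0 msuppX.
by [].
Qed.

Let d1E : d1 = (N * M)%N.
Proof. by rewrite /d1 /ls1 (sumn_rect N id) map_id. Qed.

Let d2E : d2 = (N * (K * N - M))%N.
Proof. by rewrite /d2 /ls2 (sumn_rect N (fun l => N - l)%N) (proj1 (sumn_compl LN)). Qed.

(** Parts of [nu] are at most [d1], so they fit in width [K * N + d1]; the extra [d1] is matched on
    the other side by the shift in [sh2]. *)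
Let sh1 (nu : {ffun 'I_d1 -> 'I_d1.+1}) : bshape D :=
  shape_of D (box_compl (K * N + d1) N (nth 0%N (part_of nu))).
Let sh2 (nu : {ffun 'I_d2 -> 'I_d2.+1}) : bshape D :=
  shape_of D (shift_rows d1 N (nth 0%N (part_of nu))).
Let Q d (nu : {ffun 'I_d -> 'I_d.+1}) := ispart nu && (nth 0%N (part_of nu) N == 0%N).

Let ND : (N <= D)%N.
Proof. by rewrite /D -!addnA leq_addr. Qed.

Let good1 nu : Q nu -> row_len (sh1 nu) = box_compl (K * N + d1) N (nth 0%N (part_of nu))
  /\ good_shape N (sh1 nu).
Proof.
case/andP => pn /eqP nN; apply: good_shape_of => // i; rewrite /box_compl.
- case: ifP => // iN; rewrite ifT; last by lia.
  by apply: leq_sub2l; apply: part_of_mono => //; lia.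
- by case: ifP => // _; rewrite /D; lia.
- by move=> Ni; rewrite ltnNge Ni.
Qed.

Let good2 nu : Q nu -> row_len (sh2 nu) = shift_rows d1 N (nth 0%N (part_of nu))
  /\ good_shape N (sh2 nu).
Proof.
case/andP => pn /eqP nN; apply: good_shape_of => // i; rewrite /shift_rows.
- case: ifP => // iN; rewrite ifT; last by lia.
  by rewrite leq_add2l; apply: part_of_mono.
- by case: ifP => // _; have := part_of_le i pn; rewrite /D; lia.
- by move=> Ni; rewrite ltnNge Ni.
Qed.

(** A partition with more than [N] parts has zero Gelfand-Tsetlin sum in [N] variables. *)
Let expansion_supp (y : nat -> F) d (c : seq nat -> int) : (d <= D)%N ->
  \sum_(nu : {ffun 'I_d -> 'I_d.+1} | ispart nu)
     (c (part_of nu))%:~R * gtsum D N (nth 0%N (part_of nu)) y =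
  \sum_(nu : {ffun 'I_d -> 'I_d.+1} | Q nu)
     (c (part_of nu))%:~R * gtsum D N (nth 0%N (part_of nu)) y.
Proof.
move=> dD; rewrite (bigID (fun nu => nth 0%N (part_of nu) N == 0%N)) /= [X in _ + X]big1 ?addr0 //.
move=> nu /andP[pn nN]; rewrite gtsum_long ?mulr0 //; split=> i.
  exact: leq_trans (part_of_le i pn) dD.
by move=> Di; apply: nth_default; apply: leq_trans (size_part_of nu) (leq_trans dD (ltnW Di)).
Qed.

Lemma rectangle_duality c1 c2 : lr_expansion ls1 c1 -> lr_expansion ls2 c2 ->
  c1 (strip (nseq N M)) = c2 (strip (nseq N (K * N - M)%N)).
Proof.
move=> e1 e2.
have MKN : (M <= K * N)%N := proj2 (sumn_compl LN).
have cond a : ((N * a == 0) || (N <= N * a))%N.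
  by case: a => [|a]; rewrite ?muln0 // leq_pmulr // orbT.
have nil0 l d : (nseq l N : seq nat) \in d -> sumn (map sumn d) = 0%N -> nseq l N = [::].
  elim: d => // s d IH; rewrite in_cons => /orP[/eqP <-|/IH h] /=.
    by case: l {IH} => //= l; move: N0; lia.
  by move=> e; apply: h; lia.
have rect l : (l <= N)%N -> [/\ sorted geq (nseq l N), (size (nseq l N) <= D)%N
    & (head 0%N (nseq l N) <= D)%N].
  move=> lN; rewrite size_nseq (leq_trans lN ND); split=> //; first exact: sorted_nseq.
  by case: l {lN} => //= l.
have {}e1 : \prod_(l <- L) gtsum D N (nth 0%N (nseq l N)) (fun i => (x i)^-1) =
    \sum_(nu | @Q d1 nu) (c1 (part_of nu))%:~R *
       gtsum D N (nth 0%N (part_of nu)) (fun i => (x i)^-1).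
  have d1D : (d1 <= D)%N by rewrite /D; lia.
  rewrite -(expansion_supp _ c1 d1D) -(lr_expansion_restrict (N := N) _ e1 d1D) ?big_map //.
    by rewrite -/d1 d1E.
  move=> la /[dup] lals /mapP[l lL lE]; rewrite lE; rewrite lE in lals.
  have [h1 h2 h3] := rect _ (allP LN l lL); split=> //; exact: nil0.
have {}e2 : \prod_(l <- L) gtsum D N (nth 0%N (nseq (N - l) N)) x =
    \sum_(nu | @Q d2 nu) (c2 (part_of nu))%:~R * gtsum D N (nth 0%N (part_of nu)) x.
  have d2D : (d2 <= D)%N by rewrite /D; lia.
  rewrite -(expansion_supp _ c2 d2D) -(lr_expansion_restrict (N := N) _ e2 d2D) ?big_map //.
    by rewrite -/d2 d2E.
  move=> la /[dup] lals /mapP[l lL lE]; rewrite lE; rewrite lE in lals.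
  have [h1 h2 h3] := rect _ (leq_subr l N); split=> //; exact: nil0.
(* Each of the [K] factors is complemented in the square of side [N] and contributes [P ^+ N]. *)
have compl : \prod_(l <- L) gtsum D N (nth 0%N (nseq (N - l) N)) x =
    P ^+ (K * N) * \prod_(l <- L) gtsum D N (nth 0%N (nseq l N)) (fun i => (x i)^-1).
  rewrite /K; elim: (L) LN => [|l L' IH] /=; first by rewrite !big_nil mulr1.
  case/andP => lN /IH h; rewrite !big_cons h mulSn exprD -box_compl_rect //.
  rewrite gtsum_compl //; first by rewrite -/P mulrACA.
  - exact: leqW.
  - have [h1 h2 h3] := rect _ lN; by case: (in_box_nth h1 h2 h3).
  - by move=> i; rewrite nth_nseq; case: ifP.
  - by move=> i Ni; rewrite nth_nseq ltnNge (leq_trans lN Ni).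
(* The second expansion is multiplied by [P ^+ d1], the first, in inverse variables, by
   [P ^+ (K * N + d1)]; each power is absorbed into the shapes. *)
have eF : \sum_(nu | @Q d2 nu) (c2 (part_of nu))%:~R * gtsum D N (row_len (sh2 nu)) x =
          \sum_(nu | @Q d1 nu) (c1 (part_of nu))%:~R * gtsum D N (row_len (sh1 nu)) x.
  transitivity (P ^+ d1 * \sum_(nu | @Q d2 nu) (c2 (part_of nu))%:~R *
     gtsum D N (nth 0%N (part_of nu)) x).
    rewrite mulr_sumr; apply: eq_bigr => nu qn; rewrite (proj1 (good2 qn)) mulrCA.
    have /andP[pn /eqP nN] := qn; rewrite (gtsum_shift (B := d2)) //.
    - exact: leqW.
    - by rewrite /D; lia.
    - by move=> i; apply: part_of_le.
    - by move=> i; apply: part_of_supp nN.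
  rewrite -e2 compl e1 mulrA -exprD mulr_sumr; apply: eq_bigr => nu qn.
  rewrite (proj1 (good1 qn)) mulrCA.
  have /andP[pn /eqP nN] := qn; rewrite gtsum_compl //.
  - by rewrite addnC.
  - exact: leqW.
  - by rewrite /D; lia.
  - split=> i; first by apply: leq_trans (part_of_le i pn) _; rewrite /D; lia.
    by move=> Di; apply: (part_of_supp pn nN); apply: leq_trans ND (ltnW Di).
  - by move=> i; apply: leq_trans (part_of_le i pn) (leq_addl _ _).
  - by move=> i; apply: part_of_supp nN.
(* Both sides are now polynomials, and the embedding into the fraction field is injective. *)
have ePoly : \sum_(nu | @Q d2 nu) c2 (part_of nu) *: gtsum D N (row_len (sh2 nu)) (mvar N) =
             \sum_(nu | @Q d1 nu) c1 (part_of nu) *: gtsum D N (row_len (sh1 nu)) (mvar N).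
  apply/eqP; rewrite -tofrac_eq; apply/eqP; rewrite !rmorph_sum /=.
  have term (c : int) la : FracField.tofrac (c *: gtsum D N la (mvar N)) = c%:~R * gtsum D N la x.
    rewrite -[c in LHS]intz scaler_int -mulrzl rmorphM rmorph_int /= rmorph_gtsum //.
  under eq_bigr => nu _ do rewrite term.
  under [RHS]eq_bigr => nu _ do rewrite term.
  exact: eF.
(* The common image of the two rectangles: the complement of [(M^N)] in width [K * N + d1], which is
   also [((KN-M)^N)] shifted by [d1]. *)
pose g i := (if i < N then K * N + d1 - M else 0)%N.
have [gE gg] : row_len (shape_of D g) = g /\ good_shape N (shape_of D g).
  apply: good_shape_of => // i; rewrite /g.
  - by case: ifP => // iN; rewrite ifT //; lia.
  - by case: ifP => // _; rewrite /D; lia.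
  - by move=> Ni; rewrite ltnNge Ni.
(* With [M] and the parts of [nu] at most [d1], the subtractions from [K * N + d1] are not truncated
   and can be cancelled. *)
have Md1 : (M <= d1)%N by rewrite d1E leq_pmull.
have := gtsum_coef_unique ND N0 (fun j q => proj2 (good2 q)) (fun j q => proj2 (good1 q)) ePoly gg.
rewrite (sum_over_rect c2 N0 d2E) //; last first.
  move=> nu pn nN; have qn : Q nu by rewrite /Q pn nN eqxx.
  apply/eqP/forallP => [e i|h].
    have := congr1 (fun m => row_len m i) e; rewrite gE (proj1 (good2 qn)).
    by rewrite /shift_rows /g ltn_ord; lia.
  rewrite -[LHS]row_lenK (proj1 (good2 qn)); congr shape_of.
  apply: functional_extensionality => i; rewrite /shift_rows /g; case: ifP => // iN.
  by have /eqP := h (Ordinal iN); rewrite /=; lia.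
rewrite (sum_over_rect c1 N0 d1E) //.
move=> nu pn nN; have qn : Q nu by rewrite /Q pn nN eqxx.
apply/eqP/forallP => [e i|h].
  (* Row [N.-1 - i] is read because complementing reverses the rows. *)
  have := congr1 (fun m => row_len m (N.-1 - i)%N) e; rewrite gE (proj1 (good1 qn)).
  have lt : (N.-1 - i < N)%N by move: N0; lia.
  rewrite /box_compl /g lt.
  have -> : (N.-1 - (N.-1 - i) = i)%N by have := ltn_ord i; lia.
  by have := part_of_le i pn; lia.
rewrite -[LHS]row_lenK (proj1 (good1 qn)); congr shape_of.
apply: functional_extensionality => i; rewrite /box_compl /g; case: ifP => // iN.
have lt : (N.-1 - i < N)%N by lia.
by have /eqP := h (Ordinal lt); rewrite /= => ->.
Qed.

End RectangleDuality.

Local Close Scope ring_scope.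

Theorem theorem6p2 (N : nat) (L : seq nat) :
  (0 < N)%N -> (0 < size L)%N -> sorted geq L -> (head 0%N L <= N)%N ->
  lrc [seq nseq l N | l <- L] (nseq N (sumn L)) =
  lrc [seq nseq (N - l) N | l <- L] (nseq N (size L * N - sumn L)).
Proof.
move=> N0 _ sL hL.
have LN : all (fun l => l <= N)%N L.
  apply/allP => l lL; rewrite -(nth_index 0%N lL); apply: leq_trans hL.
  by rewrite -nth0; apply: nonincr_le => // k; apply: nth_sorted_geq.
have [c1 e1 ->] : exists2 c, lr_expansion [seq nseq l N | l <- L] c &
    forall mu, lrc [seq nseq l N | l <- L] mu = c (strip mu).
  by apply: lrcP => la /mapP[l _ ->]; apply: sorted_nseq.
have [c2 e2 ->] : exists2 c, lr_expansion [seq nseq (N - l) N | l <- L] c &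
    forall mu, lrc [seq nseq (N - l) N | l <- L] mu = c (strip mu).
  by apply: lrcP => la /mapP[l _ ->]; apply: sorted_nseq.
exact: rectangle_duality.
Qed.
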